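(* Let $\alpha>0$ and let $f$ be a continuous function on $[0,\infty)$ which is of $w$-weighted exponential order, where $w$ is a continuous weight function on $[0,\infty)$. Then: \begin{enumerate} \item $\displaystyle\mathcal{L}_{w(x)}\left\{\left({}^{RL}_{0}I^{\alpha}_{x;w(x)}f\right)(x)\right\}=s^{-\alpha}\mathcal{L}_{w(x)}\{f(x)\}.$ \item Let $n-1\le\mathrm{Re}(\alpha)<n\in\mathbb{Z}^+$, and assume that ${}^{RL}_{0}D^{\alpha}_{x;w(x)}f$ is continuous on $[0,\infty)$ and of $w$-weighted exponential order. Then $$\mathcal{L}_{w(x)}\left\{\left({}^{RL}_{0}D^{\alpha}_{x;w(x)}f\right)(x)\right\}=s^{\alpha}\mathcal{L}_{w(x)}\{f(x)\}-w(0^+)\sum_{i=0}^{n-1}s^{n-i-1}\left({}^{RL}_{0}I^{n-i-\alpha}_{x;w(x)}f\right)(0^+).$$ \item Let $n-1\le\mathrm{Re}(\alpha)<n\in\mathbb{Z}^+$, and assume that ${}^{RL}_{0}D^{n}_{x;w(x)}f$ is continuous on $[0,\infty)$ and of $w$-weighted exponential order. Then $$\mathcal{L}_{w(x)}\left\{\left({}^{C}_{0}D^{\alpha}_{x;w(x)}f\right)(x)\right\}=s^{\alpha}\mathcal{L}_{w(x)}\{f(x)\}-w(0^+)\sum_{i=0}^{n-1}s^{\alpha-i-1}\left[\left(\frac{d}{dx}+\frac{w'(x)}{w(x)}\right)^if\right](0^+).$$ \end{enumerate}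
   Context: The weight $w$ is nowhere zero and, where derivatives are involved, sufficiently differentiable for the operators to be defined. The weighted Laplace transform of $f:[0,\infty)\to\mathbb{C}$ is $\mathcal{L}_{w(x)}\{f(x)\}=F(s)=\int_0^\infty e^{-sx}w(x)f(x)\,dx$, for $s\in\mathbb{C}$ for which the integral converges; the identities are identities of functions of $s$ for $\mathrm{Re}(s)$ sufficiently large. A function $f$ is of $w$-weighted exponential order if $wf$ is of exponential order, i.e. there are constants $c$, $M,T>0$ with $|w(x)f(x)|\le Me^{cx}$ for all $x\ge T$. Weighted operators with lower limit $0$: for $\mathrm{Re}(\alpha)>0$, $${}^{RL}_{0}I^{\alpha}_{x;w(x)}f(x)=\frac{1}{\Gamma(\alpha)w(x)}\int_0^x(x-t)^{\alpha-1}w(t)f(t)\,dt;$$ for $\mathrm{Re}(\alpha)\ge0$ and $n=\lfloor\mathrm{Re}(\alpha)\rfloor+1$, $${}^{RL}_{0}D^{\alpha}_{x;w(x)}f(x)=\left(\frac{d}{dx}+\frac{w'(x)}{w(x)}\right)^n{}^{RL}_{0}I^{n-\alpha}_{x;w(x)}f(x),\qquad {}^{C}_{0}D^{\alpha}_{x;w(x)}f(x)={}^{RL}_{0}I^{n-\alpha}_{x;w(x)}\left(\frac{d}{dx}+\frac{w'(x)}{w(x)}\right)^nf(x).$$ For integer order $n\in\mathbb{N}$, ${}^{RL}_{0}D^{n}_{x;w(x)}f$ is $\left(\frac{d}{dx}+\frac{w'(x)}{w(x)}\right)^nf$. Integrals of order with non-positive real part are defined by ${}^{RL}_{0}I^{-\gamma}_{x;w(x)}:={}^{RL}_{0}D^{\gamma}_{x;w(x)}$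 for $\mathrm{Re}(\gamma)\ge0$. The notation $g(0^+)$ means $\lim_{x\to0^+}g(x)$. *)

(* Defs.v *)
From HB Require Import structures.
From mathcomp Require Import all_boot all_order all_algebra.
From mathcomp Require Import all_classical all_reals all_analysis.
From mathcomp.real_closed Require Export complex.
Import Order.TTheory GRing.Theory Num.Theory.
Import numFieldNormedType.Exports.

Set Implicit Arguments.
Unset Strict Implicit.
Unset Printing Implicit Defensive.

Local Open Scope classical_set_scope.
Local Open Scope ring_scope.
Local Open Scope complex_scope.

(* A function [0, oo[ -> C is represented by g : R -> R[i] whose values at
   negative reals are irrelevant; derivatives are only used at x > 0.  R[i]^o
   is R[i] as a normed module over itself, hence with its usual topology. *)
Section WeightedOperators.
Variable R : realType.
Implicit Types (z a s : R[i]) (w f g : R -> R[i]) (x : R) (D : set R).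

Local Notation Re := (@complex.Re R).
Local Notation Im := (@complex.Im R).

Definition cexp z : R[i] :=
  (expR (Re z) * cos (Im z)) +i* (expR (Re z) * sin (Im z)).

(* Principal argument, with values in ]-pi, pi] (for z != 0). *)
Definition carg z : R :=
  let t := acos (Re z / Re `|z|) in if 0 <= Im z then t else - t.

Definition clog z : R[i] := ln (Re `|z|) +i* carg z.

(* Principal branch of z ^ a for z != 0; the value at z = 0 is irrelevant here
   (it only occurs at single points of integration domains). *)
Definition cpow z a : R[i] := cexp (a * clog z).

Definition cintegrable D g : Prop :=
  lebesgue_measure.-integrable D (EFin \o (Re \o g)) /\
  lebesgue_measure.-integrable D (EFin \o (Im \o g)).

Definition cintegral D g : R[i] :=
  Rintegral lebesgue_measure D (Re \o g) +i*
  Rintegral lebesgue_measure D (Im \o g).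

Definition cderivable g x : Prop :=
  derivable (Re \o g) x 1 /\ derivable (Im \o g) x 1.

Definition cderive g x : R[i] := derive1 (Re \o g) x +i* derive1 (Im \o g) x.

Definition cvg0 g : Prop := cvg ((g x : R[i]^o) @[x --> (0 : R)^'+]).

Definition lim0 g : R[i] := lim ((g x : R[i]^o) @[x --> (0 : R)^'+]).

Definition continuous_ge0 g : Prop :=
  {within `[0, +oo[, continuous (g : R -> R[i]^o)}.

(* Continuity on [0, oo[ of a function that is given by a differential
   expression on ]0, oo[, its value at 0 being the limit there. *)
Definition extends_continuous_ge0 g : Prop :=
  (forall x, 0 < x -> {for x, continuous (g : R -> R[i]^o)}) /\ cvg0 g.

(* Gamma function, for 0 < Re z. *)
Definition cGamma z : R[i] :=
  cintegral `]0, +oo[ (fun t => cpow t%:C (z - 1) * (expR (- t))%:C).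

Definition wlaplace_cvg w f s : Prop :=
  cintegrable `[0, +oo[ (fun x => cexp (- s * x%:C) * w x * f x).

Definition wlaplace w f s : R[i] :=
  cintegral `[0, +oo[ (fun x => cexp (- s * x%:C) * w x * f x).

Definition wexp_order w f : Prop :=
  exists c M T : R, [/\ 0 < M, 0 < T &
    forall x, T <= x -> `|w x * f x| <= (M * expR (c * x))%:C].

Definition for_large_Re (P : R[i] -> Prop) : Prop :=
  exists sigma : R, forall s, sigma < Re s -> P s.

(* d/dx + w'/w *)
Definition wD w g : R -> R[i] :=
  fun x => cderive g x + cderive w x / w x * g x.

(* (d/dx + w'/w)^n g exists on ]0, oo[. *)
Definition wD_defined w n g : Prop :=
  forall k, (k < n)%N -> forall x, 0 < x ->
    cderivable w x /\ cderivable (iter k (wD w) g) x.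

(* Riemann-Liouville integral of order a, for 0 < Re a. *)
Definition RLint_pos w a f : R -> R[i] := fun x =>
  (cGamma a * w x)^-1 *
  cintegral `[0, x] (fun t => cpow (x - t)%:C (a - 1) * w t * f t).

(* floor (Re a) + 1, for 0 <= Re a *)
Definition frac_order a : nat := (Num.truncn (Re a)).+1.

Definition is_nat_order a : bool := a == (Num.truncn (Re a))%:R.

(* Riemann-Liouville derivative of order a, for 0 <= Re a. *)
Definition RLder w a f : R -> R[i] :=
  if is_nat_order a then iter (Num.truncn (Re a)) (wD w) f
  else iter (frac_order a) (wD w) (RLint_pos w ((frac_order a)%:R - a) f).

Definition RLder_defined w a f : Prop :=
  if is_nat_order a then wD_defined w (Num.truncn (Re a)) f
  else wD_defined w (frac_order a) (RLint_pos w ((frac_order a)%:R - a) f).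

(* Riemann-Liouville integral of arbitrary complex order. *)
Definition RLint w a f : R -> R[i] :=
  if 0 < Re a then RLint_pos w a f else RLder w (- a) f.

(* Caputo derivative of order a, for 0 <= Re a. *)
Definition Cder w a f : R -> R[i] :=
  RLint w ((frac_order a)%:R - a) (iter (frac_order a) (wD w) f).

End WeightedOperators.

(* Main.v *)
(** Multiplying by w turns the weighted operators into the classical ones:
    w * RLint_pos w a f is the convolution of t^(a-1) / Gamma(a) with w f, and
    w * (d/dx + w'/w) g = (w g)'.  By Fubini the Laplace transform of the
    convolution is a product, and the transform of t^(a-1) is Gamma(a) s^(-a):
    along the ray s = exp(theta log s0) the quantity s^a L{t^(a-1)}(s) has zero
    derivative in theta.  Gamma(a) does not vanish on the right half plane: by
    Gamma(a + 1) = a Gamma(a) it is enough that Gamma(x + i y) <> 0 for x large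
    with respect to y, where t^(i y) is nearly constant under the Gamma law.
    Derivatives are handled by n integrations by parts; if G^(n) has a limit at
    0+ and exponential order, so do all G^(k), k <= n. *)
Require Import Defs.
From HB Require Import structures.
From mathcomp Require Import all_boot all_order all_algebra.
From mathcomp Require Import all_classical all_reals all_analysis.
From mathcomp Require Import measurable_realfun ring lra.
Import Order.TTheory GRing.Theory Num.Theory.
Import numFieldNormedType.Exports.
Set Implicit Arguments.
Unset Strict Implicit.
Unset Printing Implicit Defensive.

Local Open Scope classical_set_scope.
Local Open Scope ring_scope.
Local Open Scope complex_scope.

(** A single integration by parts, s L{t^a}(s) = a L{t^(a-1)}(s), serves twice: at s = 1 it is the
    functional equation of Gamma, and along the ray it is exactly the vanishing of the derivative in
    theta. The formula for complex s thus follows from differentiation under a real integral,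
    without rotating a contour. Every integrability claim about the kernels goes back to one
    positive function with an explicit bounded primitive. Non-vanishing of Gamma cannot be avoided:
    the fractional integral divides by [cGamma a], and that factor must cancel against the one
    produced by the transform of the kernel. Two obstacles shape the rest. The limits at 0+ in the
    boundary terms are conclusions, not assumptions, so regularity is carried downwards from the
    highest derivative to its successive primitives. For an integer order alpha = m the index n is m
    + 1, while the Riemann-Liouville derivative is only an m-fold derivative; the surplus boundary
    term is an integral of order 1, which vanishes at 0+. *)

(** * Modulus, exponential, logarithm and powers of complex numbers *)

Section ComplexAlgebra.
Variable R : realType.
Implicit Types (z a b s : R[i]) (x y : R).
Local Notation Re := (@complex.Re R).
Local Notation Im := (@complex.Im R).

Lemma complexP a b : Re a = Re b -> Im a = Im b -> a = b.
Proof. by case: a b => [? ?] [? ?] /= -> ->. Qed.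

Lemma ReM a b : Re (a * b) = Re a * Re b - Im a * Im b.
Proof. by case: a b => [? ?] [? ?]. Qed.

Lemma ImM a b : Im (a * b) = Re a * Im b + Im a * Re b.
Proof. by case: a b => [? ?] [? ?] /=. Qed.

Lemma ReD a b : Re (a + b) = Re a + Re b.
Proof. by case: a b => [? ?] [? ?]. Qed.

Lemma ImD a b : Im (a + b) = Im a + Im b.
Proof. by case: a b => [? ?] [? ?] /=. Qed.

Lemma ReN a : Re (- a) = - Re a.
Proof. by case: a. Qed.

Lemma ImN a : Im (- a) = - Im a.
Proof. by case: a. Qed.

Lemma ReC x : Re x%:C = x. Proof. by []. Qed.

Lemma ImC x : Im x%:C = 0. Proof. by []. Qed.

Lemma Re1 : Re 1 = 1. Proof. by []. Qed.

Lemma Im1 : Im 1 = 0. Proof. by []. Qed.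

Lemma Re_nat n : Re n%:R = n%:R.
Proof. by elim: n => // n ih; rewrite -addn1 !natrD ReD ih. Qed.

Lemma Im_nat n : Im n%:R = 0.
Proof. by elim: n => // n ih; rewrite -addn1 !natrD ImD ih addr0. Qed.

Definition ReImE :=
  (ReM, ImM, ReD, ImD, ReN, ImN, ReC, ImC, Re1, Im1, Re_nat, Im_nat).

(** The norm of [R[i]] takes values in [R[i]]; [cmod] moves it to [R], where it can be compared with
    integrable real majorants. *)
Definition cmod z : R := Re `|z|.

Lemma cmodE z : `|z| = (cmod z)%:C.
Proof. by rewrite /cmod normc_def. Qed.

Lemma cmod_ge0 z : 0 <= cmod z.
Proof. by rewrite /cmod normc_def sqrtr_ge0. Qed.

Lemma cmodM a b : cmod (a * b) = cmod a * cmod b.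
Proof. by rewrite /cmod normrM !cmodE ReM /= mul0r subr0. Qed.

Lemma cmodD a b : cmod (a + b) <= cmod a + cmod b.
Proof.
by have := ler_normD a b; rewrite !cmodE lecE /= => /andP[_].
Qed.

Lemma cmodN a : cmod (- a) = cmod a.
Proof. by rewrite /cmod normrN. Qed.

Lemma cmod_sqr z : cmod z ^+ 2 = Re z ^+ 2 + Im z ^+ 2.
Proof. by rewrite /cmod normc_def /= sqr_sqrtr// addr_ge0// sqr_ge0. Qed.

Lemma cmod_eq0 z : (cmod z == 0) = (z == 0).
Proof. by rewrite -(normr_eq0 z) cmodE eq_complex /= eqxx andbT. Qed.

Lemma cmodC x : cmod x%:C = `|x|.
Proof. by rewrite /cmod normc_def /= expr0n addr0 sqrtr_sqr. Qed.

Lemma cmod0 : cmod 0 = 0.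
Proof. by rewrite cmodC normr0. Qed.

Lemma normRe_cmod z : `|Re z| <= cmod z.
Proof.
rewrite -(@ler_pXn2r _ 2)// ?nnegrE ?cmod_ge0 ?normr_ge0//.
by rewrite cmod_sqr real_normK ?num_real// lerDl sqr_ge0.
Qed.

Lemma normIm_cmod z : `|Im z| <= cmod z.
Proof.
rewrite -(@ler_pXn2r _ 2)// ?nnegrE ?cmod_ge0 ?normr_ge0//.
by rewrite cmod_sqr real_normK ?num_real// lerDr sqr_ge0.
Qed.

Lemma cmod_le z : cmod z <= `|Re z| + `|Im z|.
Proof.
rewrite -(@ler_pXn2r _ 2)// ?nnegrE ?cmod_ge0 ?addr_ge0 ?normr_ge0//.
rewrite cmod_sqr sqrrD !real_normK ?num_real// lerD2r lerDl.
by rewrite mulrn_wge0// mulr_ge0.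
Qed.

Lemma scaleRE x y : x *: (y : R^o) = x * y. Proof. by []. Qed.

Lemma Re_cexp z : Re (cexp z) = expR (Re z) * cos (Im z). Proof. by []. Qed.

Lemma Im_cexp z : Im (cexp z) = expR (Re z) * sin (Im z). Proof. by []. Qed.

Lemma cexpE z : cexp z = (expR (Re z))%:C * (cos (Im z) +i* sin (Im z)).
Proof. by apply: complexP; rewrite !ReImE /= !mul0r ?subr0 ?addr0. Qed.

Lemma cexpD a b : cexp (a + b) = cexp a * cexp b.
Proof.
case: a b => [u v] [u' v']; apply: complexP; rewrite /= expRD ?cosD ?sinD; ring.
Qed.

Lemma cexp0 : cexp (0 : R[i]) = 1.
Proof. by apply: complexP; rewrite /= expR0 ?cos0 ?sin0 ?mulr1 ?mulr0. Qed.

Lemma cmod_cexp z : cmod (cexp z) = expR (Re z).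
Proof.
apply/eqP; rewrite -(@eqrXn2 _ 2)// ?cmod_ge0 ?expR_ge0// cmod_sqr.
by rewrite /cexp /= !exprMn -mulrDr cos2Dsin2 mulr1.
Qed.

Lemma cexp_neq0 z : cexp z != 0.
Proof. by rewrite -cmod_eq0 cmod_cexp gt_eqF// expR_gt0. Qed.

Lemma cexpN z : cexp (- z) = (cexp z)^-1.
Proof.
apply: (mulfI (cexp_neq0 z)); rewrite -cexpD subrr cexp0 divff//.
exact: cexp_neq0.
Qed.

Lemma cexpMn z n : cexp (n%:R * z) = cexp z ^+ n.
Proof.
elim: n => [|n ih]; first by rewrite mul0r cexp0 expr0.
by rewrite -addn1 natrD mulrDl mul1r cexpD ih exprD expr1.
Qed.

Lemma cexpC x : cexp x%:C = (expR x)%:C.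
Proof. by apply: complexP; rewrite /= ?cos0 ?sin0 ?mulr1 ?mulr0. Qed.

Lemma Re_div_cmod z : z != 0 -> -1 <= Re z / cmod z <= 1.
Proof.
move=> z0; have c0 : 0 < cmod z by rewrite lt_neqAle eq_sym cmod_eq0 z0 cmod_ge0.
by rewrite -ler_norml normrM normfV (gtr0_norm c0) ler_pdivrMr// mul1r normRe_cmod.
Qed.

(** [acos] recovers only the cosine of the argument. Its sine is [Im z / cmod z] up to sign, because
    1 - (Re z / |z|)^2 = (Im z / |z|)^2, and the sign test in [carg] settles the sign. *)
Lemma cexp_clog z : z != 0 -> cexp (clog z) = z.
Proof.
move=> z0; have c0 : 0 < cmod z by rewrite lt_neqAle eq_sym cmod_eq0 z0 cmod_ge0.
have b := Re_div_cmod z0.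
rewrite cexpE /clog /= -/(cmod z) lnK ?posrE//.
have cs : cos (carg z) = Re z / cmod z.
  rewrite /carg -/(cmod z); case: ifP => _; rewrite ?cosN acosK//;
  by rewrite in_itv/=.
have sn : sin (carg z) = Im z / cmod z.
  rewrite /carg -/(cmod z).
  have E : Num.sqrt (1 - (Re z / cmod z) ^+ 2) = `|Im z| / cmod z.
    have -> : 1 - (Re z / cmod z) ^+ 2 = (Im z / cmod z) ^+ 2.
      rewrite !expr_div_n; apply: (@mulIf _ (cmod z ^+ 2)).
        by rewrite expf_neq0// gt_eqF.
      rewrite mulrBl !divfK ?expf_neq0 ?gt_eqF// mul1r cmod_sqr.
      by rewrite addrC addKr.
    by rewrite sqrtr_sqr normrM normfV (gtr0_norm c0).
  case: ifPn => h; rewrite ?sinN sin_acos// E.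
    by rewrite ger0_norm.
  by rewrite ltr0_norm ?ltNge// mulNr opprK.
by apply: complexP; rewrite !ReImE /= cs sn mul0r ?subr0 ?addr0 mulrC divfK// gt_eqF.
Qed.

Lemma cpowD z a b : cpow z (a + b) = cpow z a * cpow z b.
Proof. by rewrite /cpow mulrDl cexpD. Qed.

Lemma cpowN z a : cpow z (- a) = (cpow z a)^-1.
Proof. by rewrite /cpow mulNr cexpN. Qed.

Lemma cpow_nat z n : z != 0 -> cpow z n%:R = z ^+ n.
Proof. by move=> z0; rewrite /cpow cexpMn cexp_clog. Qed.

Lemma clogC x : 0 < x -> clog x%:C = (ln x)%:C.
Proof.
move=> x0; have xE : cmod x%:C = x by rewrite cmodC gtr0_norm.
apply: complexP; first by rewrite [LHS]/= -{2}xE.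
suff : carg x%:C = 0 by [].
by rewrite /carg -/(cmod x%:C) xE /= lexx divff ?gt_eqF// acos1.
Qed.

(** The strict inequality leaves room to follow the ray exp(theta log z) slightly beyond theta = 1
    inside the right half plane. *)
Lemma carg_Re_gt0 z : 0 < Re z -> `|carg z| < pi / 2.
Proof.
move=> r0; have z0 : z != 0 by apply: contraTneq r0 => ->; rewrite ltxx.
have c0 : 0 < cmod z by rewrite lt_neqAle eq_sym cmod_eq0 z0 cmod_ge0.
have b := Re_div_cmod z0.
have t0 : 0 <= acos (Re z / cmod z) by rewrite acos_ge0.
have H : acos (Re z / cmod z) < pi / 2.
  rewrite ltNge; apply/negP => h.
  have : cos (acos (Re z / cmod z)) <= cos (pi / 2).
    rewrite leNgt ltr_cos ?in_itv/= ?t0 ?acos_lepi// -?leNgt//.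
    by have := pi_ge0 R; lra.
  rewrite cos_pihalf acosK ?in_itv//= leNgt => /negP; apply.
  by rewrite divr_gt0.
rewrite /carg -/(cmod z); case: ifP => _; rewrite ?normrN ger0_norm//.
Qed.

End ComplexAlgebra.

(** * Fundamental theorem of calculus on the open half line *)

Section RealFTC.
Variable R : realType.
Notation mu := (@lebesgue_measure R).
Implicit Types (g E : R -> R).

(** Compact exhaustion of the open half line; the shift by 2 makes already the first interval,
    [1/2, 2], nondegenerate. *)
Definition itvn (n : nat) : set R := `[n.+2%:R^-1, n.+2%:R].

Lemma itvn_bigcup : \bigcup_n itvn n = `](0 : R), +oo[%classic.
Proof.
apply/seteqP; split=> [x [n _] /=|x /=]; rewrite /itvn/= !in_itv/= ?andbT.
  by move=> /andP[+ _]; apply: lt_le_trans; rewrite invr_gt0.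
move=> x0; have [n nx] : exists n : nat, x + x^-1 <= n%:R.
  by exists (Num.truncn (x + x^-1)).+1; rewrite ltW// truncnS_gt.
have n2 : (n%:R <= n.+2%:R :> R) by rewrite ler_nat -addn2 leq_addr.
exists n => //; rewrite /itvn /= in_itv/=; apply/andP; split.
  rewrite invf_ple ?posrE// (le_trans _ n2)// (le_trans _ nx)// lerDr.
  exact: ltW.
by rewrite (le_trans _ n2)// (le_trans _ nx)// lerDl invr_ge0 ltW.
Qed.

Lemma itvn_nondecreasing : nondecreasing_seq itvn.
Proof.
move=> m n mn; rewrite subsetEset; apply: subset_itv; rewrite bnd_simp.
  by rewrite lef_pV2 ?posrE// ler_nat.
by rewrite ler_nat.
Qed.

Lemma integral_itvn g E (n : nat) :
  (forall x : R, 0 < x -> is_derive x 1 E (g x)) ->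
  (forall x : R, 0 < x -> {for x, continuous g}) ->
  (\int[mu]_(x in itvn n) (g x)%:E = (E n.+2%:R - E n.+2%:R^-1)%:E)%E.
Proof.
move=> dE cg; rewrite EFinB; apply: continuous_FTC2.
- rewrite (@lt_trans _ _ 1)// ?ltr1n// invf_lt1// ltr1n//.
- apply/continuous_within_itvP.
    by rewrite (@lt_trans _ _ 1)// ?ltr1n// invf_lt1// ltr1n//.
  split.
  + move=> x; rewrite in_itv/= => /andP[h _]; apply: cg.
    by rewrite (lt_trans _ h)// invr_gt0.
  + by apply: cvg_at_right_filter; apply: cg; rewrite invr_gt0.
  + by apply: cvg_at_left_filter; apply: cg.
- have cE x : 0 < x -> {for x, continuous E}.
    move=> x0; apply/differentiable_continuous/derivable1_diffP.
    by have [] := dE _ x0.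
  split.
  + move=> x; rewrite in_itv/= => /andP[h _]; apply: ex_derive.
    by apply: dE; rewrite (lt_trans _ h)// invr_gt0.
  + by apply: cvg_at_right_filter; apply: cE; rewrite invr_gt0.
  + by apply: cvg_at_left_filter; apply: cE.
- move=> x; rewrite in_itv/= => /andP[h _]; rewrite derive1E.
  by apply: derive_val; apply: dE; rewrite (lt_trans _ h)// invr_gt0.
Qed.

Lemma cvg_itvn E (l0 l1 : R) : E x @[x --> 0^'+] --> l0 -> E x @[x --> +oo] --> l1 ->
  (E n.+2%:R - E n.+2%:R^-1)%:E @[n --> \oo] --> (l1 - l0)%:E.
Proof.
move=> E0 E1; apply: cvg_EFin; first exact: nearW.
have n2y : n.+2%:R @[n --> \oo] --> (+oo : set_system R).
  apply/cvgryPge => A; near=> n.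
  apply: (@le_trans _ _ n%:R); last by rewrite ler_nat -addn2 leq_addr.
  near: n; exact: nbhs_infty_ger.
apply: cvgB; first exact: cvg_comp n2y E1.
move/cvg_at_rightP : E0; apply; split=> [n|]; first by rewrite invr_gt0.
apply/cvgrPdist_lt => e e0; near=> n; rewrite sub0r normrN gtr0_norm ?invr_gt0//.
rewrite invf_plt ?posrE// (@lt_le_trans _ _ n.+1%:R)// ?ler_nat//.
rewrite (@le_lt_trans _ _ n%:R) ?ltr_nat//.
near: n; exact: nbhs_infty_ger.
Unshelve. all: by end_near. Qed.

Lemma measurable_fun_pos g :
  (forall x : R, 0 < x -> {for x, continuous g}) -> measurable_fun `](0 : R), +oo[ g.
Proof.
move=> cg; apply: open_continuous_measurable_fun => //.
by move=> x; rewrite inE/= in_itv/= andbT; exact: cg.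
Qed.

Lemma itvn_sub (n : nat) : itvn n `<=` `](0 : R), +oo[.
Proof. by rewrite -itvn_bigcup; exact: bigcup_sup. Qed.

Lemma is_derive_cont g (x d : R) : is_derive x 1 g d -> {for x, continuous g}.
Proof. by move=> [h _]; apply/differentiable_continuous/derivable1_diffP. Qed.

(** Monotone convergence along [itvn]. Integrability of [g] is not assumed, so this can prove it
    from a primitive with finite limits. *)
Lemma ge0_FTC_0y g E (l0 l1 : R) :
  (forall x : R, 0 < x -> is_derive x 1 E (g x)) ->
  (forall x : R, 0 < x -> {for x, continuous g}) ->
  (forall x : R, 0 < x -> 0 <= g x) ->
  E x @[x --> 0^'+] --> l0 -> E x @[x --> +oo] --> l1 ->
  (\int[mu]_(x in `](0 : R)%R, +oo[) (g x)%:E = (l1 - l0)%:E)%E.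
Proof.
move=> dE cg g0 E0 E1.
have mg := @measurable_fun_pos g cg.
have := @ge0_nondecreasing_set_cvg_integral _ (measurableTypeR R) R itvn (EFin \o g) mu
  itvn_nondecreasing.
rewrite itvn_bigcup => H.
have {}H := H (fun i => measurable_itv _).
have mgn n : measurable_fun (itvn n) (EFin \o g).
  by apply/measurable_EFinP; apply: measurable_funS mg => //; exact: itvn_sub.
have {}H := H mgn.
apply: (cvg_unique _ (H _)) => //.
  by move=> n x /itvn_sub; rewrite /= in_itv/= andbT lee_fin; exact: g0.
rewrite (_ : (fun n => _) = (fun n : nat => (E n.+2%:R - E n.+2%:R^-1)%:E)); last first.
  by apply/funext => n; exact: (integral_itvn n dE cg).
exact: cvg_itvn.
Qed.

(** Positive and negative parts converge monotonically, and integrability keeps the difference of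
    the two limits well defined. *)
Lemma integrable_set_cvg (d : measure_display) (T : measurableType d)
    (nu : {measure set T -> \bar R}) (F : (set T)^nat) (f : T -> \bar R) :
  nondecreasing_seq F -> (forall n, measurable (F n)) ->
  nu.-integrable (\bigcup_n F n) f ->
  (\int[nu]_(x in F n) f x @[n --> \oo] --> \int[nu]_(x in \bigcup_n F n) f x)%E.
Proof.
move=> ndF mF If.
have mU : measurable (\bigcup_n F n) by exact: bigcup_measurable.
have mf := measurable_int nu If.
have sF n : F n `<=` \bigcup_n F n by exact: bigcup_sup.
rewrite integralE; under eq_fun do rewrite integralE.
apply: cvgeB.
- apply: fin_num_adde_defl; rewrite fin_numN; apply: integrable_neg_fin_num If => //.
- apply: ge0_nondecreasing_set_cvg_integral => //.
  by move=> i; apply: measurable_funS (sF i) _ => //; exact: measurable_funepos.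
- apply: ge0_nondecreasing_set_cvg_integral => //.
  by move=> i; apply: measurable_funS (sF i) _ => //; exact: measurable_funeneg.
Qed.

Lemma FTC_0y g E (l0 l1 : R) :
  (forall x : R, 0 < x -> is_derive x 1 E (g x)) ->
  (forall x : R, 0 < x -> {for x, continuous g}) ->
  mu.-integrable `](0 : R), +oo[ (EFin \o g) ->
  E x @[x --> 0^'+] --> l0 -> E x @[x --> +oo] --> l1 ->
  Rintegral mu `](0 : R), +oo[ g = l1 - l0.
Proof.
move=> dE cg Ig E0 E1.
have := @integrable_set_cvg _ _ mu itvn (EFin \o g) itvn_nondecreasing.
rewrite itvn_bigcup => /(_ (fun i => measurable_itv _) Ig) H.
suff : (\int[mu]_(x in `](0 : R)%R, +oo[) (EFin \o g) x = (l1 - l0)%:E)%E.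
  by rewrite /Rintegral => ->.
apply: (cvg_unique _ H) => //.
rewrite (_ : (fun n => _) = (fun n : nat => (E n.+2%:R - E n.+2%:R^-1)%:E)); last first.
  by apply/funext => n; exact: (integral_itvn n dE cg).
exact: cvg_itvn.
Qed.

End RealFTC.

(** * Limits and derivatives by real and imaginary parts *)

Section ComplexCalculus.
Variable R : realType.
Notation mu := (@lebesgue_measure R).
Local Notation Re := (@complex.Re R).
Local Notation Im := (@complex.Im R).
Implicit Types (g h : R -> R[i]) (l a b z : R[i]) (x : R).

(** Componentwise form of convergence, on which the real calculus acts directly; [ccvgP] ties it to
    the topology of [R[i]^o]. *)
Definition ccvg (F : set_system R) g l :=
  (Re (g x) @[x --> F] --> Re l) /\ (Im (g x) @[x --> F] --> Im l).

Definition ccont g x := ccvg (nbhs x) g (g x).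

Definition is_cder g x l :=
  is_derive x 1 (fun x => Re (g x)) (Re l) /\
  is_derive x 1 (fun x => Im (g x)) (Im l).

Section Limits.
Variables (F : set_system R).
Context {FF : Filter F}.

Lemma ccvgP g l : ((g x : R[i]^o) @[x --> F] --> (l : R[i]^o)) <-> ccvg F g l.
Proof.
split=> [/cvgrPdist_lt H|[/cvgrPdist_lt H1 /cvgrPdist_lt H2]].
  split; apply/cvgrPdist_lt => e e0.
    have e0' : 0 < e%:C by rewrite ltcR.
    apply: filterS (H _ e0') => x; rewrite cmodE ltcR; apply: le_lt_trans.
    by rewrite -ReN -ReD normRe_cmod.
  have e0' : 0 < e%:C by rewrite ltcR.
  apply: filterS (H _ e0') => x; rewrite cmodE ltcR; apply: le_lt_trans.
  by rewrite -ImN -ImD normIm_cmod.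
(* In the partial order of [R[i]], a positive radius has zero imaginary part, so [e] is a real
   number. *)
apply/cvgrPdist_lt => e; rewrite ltcE /= => /andP[/eqP e1 e0].
have -> : e = (Re e)%:C by apply: complexP.
have e2 : 0 < Re e / 2 by rewrite divr_gt0.
apply: filterS2 (H1 _ e2) (H2 _ e2) => x h1 h2.
rewrite cmodE ltcR (le_lt_trans (cmod_le _))// (splitr (Re e)) !ReImE.
exact: ltrD.
Qed.

Lemma ccvg_cst l : ccvg F (fun=> l) l.
Proof. by split; exact: cvg_cst. Qed.

Lemma ccvgC (f : R -> R) (y : R) : f x @[x --> F] --> y ->
  ccvg F (fun x => (f x)%:C) y%:C.
Proof. by move=> fy; split => //=; exact: cvg_cst. Qed.

Lemma ccvgD g h a b : ccvg F g a -> ccvg F h b -> ccvg F (fun x => g x + h x) (a + b).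
Proof.
move=> [g1 g2] [h1 h2]; split; rewrite ?ReD ?ImD.
  by under eq_fun do rewrite ReD; exact: cvgD.
by under eq_fun do rewrite ImD; exact: cvgD.
Qed.

Lemma ccvgM g h a b : ccvg F g a -> ccvg F h b -> ccvg F (fun x => g x * h x) (a * b).
Proof.
move=> [g1 g2] [h1 h2]; split; rewrite ?ReM ?ImM.
  by under eq_fun do rewrite ReM; apply: cvgB; exact: cvgM.
by under eq_fun do rewrite ImM; apply: cvgD; exact: cvgM.
Qed.

Lemma ccvg_cexp g a : ccvg F g a -> ccvg F (fun x => cexp (g x)) (cexp a).
Proof.
move=> [g1 g2].
have e : expR (Re (g x)) @[x --> F] --> expR (Re a).
  by apply: continuous_cvg g1; exact: continuous_expR.
split => /=; apply: cvgM => //; apply: continuous_cvg g2.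
  exact: continuous_cos.
exact: continuous_sin.
Qed.

Lemma near_eq_ccvg g h l : (\forall x \near F, g x = h x) ->
  ccvg F g l -> ccvg F h l.
Proof.
move=> gh [g1 g2]; split.
  apply: cvg_trans g1; apply: near_eq_cvg; apply: filterS gh => x ->//.
apply: cvg_trans g2; apply: near_eq_cvg; apply: filterS gh => x ->//.
Qed.

Lemma ccvg_cmod0 g (G : R -> R) : (\forall x \near F, cmod (g x) <= G x) ->
  G x @[x --> F] --> 0 -> ccvg F g 0.
Proof.
move=> gG G0; split; apply: norm_cvg0; apply: (squeeze_cvgr _ (cvg_cst 0) G0);
  apply: filterS gG => x; rewrite normr_ge0 /=; apply: le_trans.
  exact: normRe_cmod.
exact: normIm_cmod.
Qed.

End Limits.

Lemma is_cder_cont g x l : is_cder g x l -> ccont g x.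
Proof.
move=> [[d1 _] [d2 _]].
by split; apply/differentiable_continuous/derivable1_diffP.
Qed.

Lemma is_cder_cst a x : is_cder (fun=> a) x 0.
Proof. by split; exact: is_derive_cst. Qed.

Lemma is_cderC (f : R -> R) x (d : R) : is_derive x 1 f d ->
  is_cder (fun x => (f x)%:C) x d%:C.
Proof. by move=> fd; split => //=; exact: is_derive_cst. Qed.

Lemma is_cderD g h x a b : is_cder g x a -> is_cder h x b ->
  is_cder (fun x => g x + h x) x (a + b).
Proof.
move=> [g1 g2] [h1 h2]; split; rewrite ?ReD ?ImD.
  by under eq_fun do rewrite ReD; exact: is_deriveD.
by under eq_fun do rewrite ImD; exact: is_deriveD.
Qed.

Lemma is_cderM g h x a b : is_cder g x a -> is_cder h x b ->
  is_cder (fun x => g x * h x) x (a * h x + g x * b).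
Proof.
move=> [g1 g2] [h1 h2]; split.
  under eq_fun do rewrite ReM; apply: is_derive_eq.
  by rewrite !ReImE /GRing.scale /=; ring.
under eq_fun do rewrite ImM; apply: is_derive_eq.
by rewrite !ReImE /GRing.scale /=; ring.
Qed.

Lemma is_cder_cexp g x a : is_cder g x a ->
  is_cder (fun x => cexp (g x)) x (cexp (g x) * a).
Proof.
move=> [g1 g2]; split.
  apply: (@is_derive_eq _ _ _ (fun x => expR (Re (g x)) * cos (Im (g x)))).
  rewrite ReM Re_cexp Im_cexp !scaleRE; ring.
apply: (@is_derive_eq _ _ _ (fun x => expR (Re (g x)) * sin (Im (g x)))).
rewrite ImM Re_cexp Im_cexp !scaleRE; ring.
Qed.

Lemma is_cder_eq g x a b : is_cder g x a -> a = b -> is_cder g x b.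
Proof. by move=> ? <-. Qed.

Lemma cderivableP g x : cderivable g x -> is_cder g x (cderive g x).
Proof.
by move=> [d1 d2]; split; split => //; rewrite /cderive /= derive1E.
Qed.

End ComplexCalculus.

(** * Integrals of complex functions over real sets *)

Section ComplexIntegral.
Variable R : realType.
Notation mu := (@lebesgue_measure R).
Local Notation Re := (@complex.Re R).
Local Notation Im := (@complex.Im R).
Local Notation pos := (`](0 : R)%R, +oo[%classic).
Implicit Types (g h : R -> R[i]) (l a b z : R[i]) (x : R) (D : set R).

Definition cmfun D g :=
  measurable_fun D (fun x => Re (g x)) /\ measurable_fun D (fun x => Im (g x)).

Lemma ccont_cmfun g : (forall x, 0 < x -> ccont g x) -> cmfun pos g.
Proof.
move=> cg; split; apply: open_continuous_measurable_fun => //;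
  by move=> x; rewrite inE/= in_itv/= andbT => /cg[].
Qed.

Lemma le_cintegrable D g (G : R -> R) : measurable D -> cmfun D g ->
  mu.-integrable D (EFin \o G) -> (forall x, D x -> cmod (g x) <= G x) ->
  cintegrable D g.
Proof.
move=> mD [m1 m2] iG gG; split.
  apply: le_integrable iG => //; first exact/measurable_EFinP.
  move=> x Dx; rewrite /= lee_fin (le_trans (normRe_cmod _))//.
  by rewrite (le_trans (gG _ Dx))// ler_norm.
apply: le_integrable iG => //; first exact/measurable_EFinP.
move=> x Dx; rewrite /= lee_fin (le_trans (normIm_cmod _))//.
by rewrite (le_trans (gG _ Dx))// ler_norm.
Qed.

Lemma eq_cintegral D g h : {in D, g =1 h} -> cintegral D g = cintegral D h.
Proof.
move=> gh; congr (_ +i* _); apply: eq_Rintegral => x xD /=; by rewrite gh.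
Qed.

Lemma eq_cintegrable D g h : measurable D -> {in D, g =1 h} ->
  cintegrable D g -> cintegrable D h.
Proof.
move=> mD gh [g1 g2]; split.
  by apply: eq_integrable g1 => // x xD /=; rewrite gh.
by apply: eq_integrable g2 => // x xD /=; rewrite gh.
Qed.

Lemma integrable_EFinD D (f1 f2 : R -> R) : measurable D ->
  mu.-integrable D (EFin \o f1) -> mu.-integrable D (EFin \o f2) ->
  mu.-integrable D (EFin \o (fun x => f1 x + f2 x)).
Proof.
move=> mD i1 i2.
have -> : EFin \o (fun x => f1 x + f2 x) = ((EFin \o f1) \+ (EFin \o f2))%E.
  by apply/funext => x /=; rewrite EFinD.
exact: integrableD.
Qed.

Lemma integrable_EFinB D (f1 f2 : R -> R) : measurable D ->
  mu.-integrable D (EFin \o f1) -> mu.-integrable D (EFin \o f2) ->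
  mu.-integrable D (EFin \o (fun x => f1 x - f2 x)).
Proof.
move=> mD i1 i2.
have -> : EFin \o (fun x => f1 x - f2 x) = ((EFin \o f1) \- (EFin \o f2))%E.
  by apply/funext => x /=; rewrite EFinB.
exact: integrableB.
Qed.

Lemma integrable_EFinZ D (f : R -> R) (k : R) : measurable D ->
  mu.-integrable D (EFin \o f) ->
  mu.-integrable D (EFin \o (fun x => k * f x)).
Proof.
move=> mD i1.
have -> : EFin \o (fun x => k * f x) = (fun x => k%:E * (EFin \o f) x)%E.
  by apply/funext => x /=; rewrite EFinM.
exact: integrableZl.
Qed.

Lemma cintegrableD D g h : measurable D -> cintegrable D g -> cintegrable D h ->
  cintegrable D (fun x => g x + h x).
Proof.
move=> mD [g1 g2] [h1 h2]; split.
  by apply: eq_integrable (integrable_EFinD mD g1 h1) => // x _ /=; rewrite ReD.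
by apply: eq_integrable (integrable_EFinD mD g2 h2) => // x _ /=; rewrite ImD.
Qed.

Lemma cintegrableZ D g a : measurable D -> cintegrable D g ->
  cintegrable D (fun x => a * g x).
Proof.
move=> mD [g1 g2]; split.
  apply: eq_integrable (integrable_EFinB mD (integrable_EFinZ (Re a) mD g1)
    (integrable_EFinZ (Im a) mD g2)) => // x _ /=; by rewrite ReM.
apply: eq_integrable (integrable_EFinD mD (integrable_EFinZ (Re a) mD g2)
  (integrable_EFinZ (Im a) mD g1)) => // x _ /=; by rewrite ImM.
Qed.

Lemma cintegralD D g h : measurable D -> cintegrable D g -> cintegrable D h ->
  cintegral D (fun x => g x + h x) = cintegral D g + cintegral D h.
Proof.
move=> mD [g1 g2] [h1 h2]; apply: complexP; rewrite ?ReD ?ImD /=.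
  by rewrite -RintegralD//; apply: eq_Rintegral => x _ /=; rewrite ReD.
by rewrite -RintegralD//; apply: eq_Rintegral => x _ /=; rewrite ImD.
Qed.

Lemma cintegralZ D g a : measurable D -> cintegrable D g ->
  cintegral D (fun x => a * g x) = a * cintegral D g.
Proof.
move=> mD [g1 g2]; apply: complexP; rewrite ?ReM ?ImM /= -!RintegralZl//.
  rewrite -RintegralB//; [|exact: integrable_EFinZ|exact: integrable_EFinZ].
  by apply: eq_Rintegral => x _ /=; rewrite ReM.
rewrite -RintegralD//; [|exact: integrable_EFinZ|exact: integrable_EFinZ].
by apply: eq_Rintegral => x _ /=; rewrite ImM.
Qed.

(** The factor 2 comes from bounding the real and imaginary parts separately; it is harmless for an
    estimate that only has to tend to 0. *)
Lemma cmod_cintegral_le D g (G : R -> R) : measurable D -> cintegrable D g ->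
  mu.-integrable D (EFin \o G) -> (forall x, D x -> cmod (g x) <= G x) ->
  cmod (cintegral D g) <= 2 * Rintegral mu D G.
Proof.
move=> mD [g1 g2] iG gG; apply: (le_trans (cmod_le _)).
rewrite mulr_natl mulr2n; apply: lerD => /=.
  have H := @le_normr_Rintegral _ _ R mu D (Re \o g) mD g1; apply: (le_trans H).
  apply: le_Rintegral => //; first exact: integrable_norm.
  by move=> x Dx; exact: le_trans (normRe_cmod _) (gG _ Dx).
have H := @le_normr_Rintegral _ _ R mu D (Im \o g) mD g2; apply: (le_trans H).
apply: le_Rintegral => //; first exact: integrable_norm.
by move=> x Dx; exact: le_trans (normIm_cmod _) (gG _ Dx).
Qed.

Lemma cFTC_0y g E l0 l1 :
  (forall x, 0 < x -> is_cder E x (g x)) -> (forall x, 0 < x -> ccont g x) ->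
  cintegrable pos g ->
  ccvg 0^'+ E l0 -> ccvg +oo E l1 -> cintegral pos g = l1 - l0.
Proof.
move=> dE cg [i1 i2] [E1 E2] [F1 F2].
apply: complexP; rewrite ?ReD ?ReN ?ImD ?ImN /=.
  by apply: (@FTC_0y _ _ (fun x => Re (E x))) => // x x0;
    [have [] := dE _ x0|have [] := cg _ x0].
by apply: (@FTC_0y _ _ (fun x => Im (E x))) => // x x0;
  [have [] := dE _ x0|have [] := cg _ x0].
Qed.

(** A point is a null set, so whatever value a kernel or a differential expression takes at 0
    affects neither integrability nor the integral. *)
Lemma integrable_itv_cbnd (r : R) (b : itv_bound R) (f : R -> R) :
  (BRight r <= b)%O ->
  mu.-integrable [set` Interval (BRight r) b] (EFin \o f) ->
  mu.-integrable [set` Interval (BLeft r) b] (EFin \o f).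
Proof.
move=> rb /integrableP[mf lf].
have mf' : measurable_fun [set` Interval (BLeft r) b] (EFin \o f).
  rewrite -(@setU1itv _ _ _ _ false)//; apply/measurable_funU => //.
  by split => //; exact: measurable_fun_set1.
apply/integrableP; split => //.
rewrite -integral_itv_obnd_cbnd//.
by apply: measurableT_comp => //; exact: mf.
Qed.

Lemma integrable_0y_cy (f : R -> R) :
  mu.-integrable pos (EFin \o f) <-> mu.-integrable `[(0 : R)%R, +oo[ (EFin \o f).
Proof.
split; first exact: integrable_itv_cbnd.
by apply: integrableS => //; apply: subset_itvr; rewrite bnd_simp.
Qed.

Lemma cintegrable_0y_cy g : cintegrable `[(0 : R)%R, +oo[ g <-> cintegrable pos g.
Proof. by split=> -[/integrable_0y_cy ? /integrable_0y_cy ?]; split. Qed.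

Lemma cintegral_0y_cy g : cintegrable pos g ->
  cintegral `[(0 : R)%R, +oo[ g = cintegral pos g.
Proof.
move=> [i1 i2]; rewrite /cintegral.
by rewrite (Rintegral_itv_obnd_cbnd i1) (Rintegral_itv_obnd_cbnd i2).
Qed.

End ComplexIntegral.

(** * Integrability of x^(p-1) exp(-k x) *)

Section GammaKernel.
Variable R : realType.
Notation mu := (@lebesgue_measure R).
Local Notation pos := (`](0 : R)%R, +oo[%classic).
Implicit Types (p k x : R).

(** This is ln y <= y - 1 at y = e x; the free slope [e] lets any multiple of the logarithm be
    absorbed by a prescribed linear term. *)
Lemma ln_le_lin (e x : R) : 0 < e -> 0 < x -> ln x <= e * x - 1 - ln e.
Proof.
move=> e0 x0; rewrite lerBrDr addrC -lnM ?posrE//.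
have := @le_ln1Dx R (e * x - 1); rewrite addrCA subrr addr0; apply.
by rewrite ltrBrDr addNr mulr_gt0.
Qed.

Lemma cvg_expR_ln_0 p : 0 < p -> expR (p * ln t) @[t --> 0^'+] --> (0 : R).
Proof.
move=> p0; have lny : - ln x * p @[x --> 0^'+] --> (+oo : set_system R).
  apply: gt0_cvgMly => //; apply/cvgNrNy.
  rewrite (_ : - _ = @ln R); first exact: lnNy.
  by apply/funext => y; rewrite !fctE opprK.
rewrite (_ : (fun t => _) = (fun t => expR (- (- ln t * p)))); last first.
  by apply/funext => t; rewrite mulNr opprK mulrC.
exact: cvg_comp _ _ lny (@cvgr_expR R).
Qed.

(* The primitive (x / (1 + x)) ^ p is bounded, whatever the sign of p - 1. *)
Lemma integrable_beta_kernel p : 0 < p ->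
  mu.-integrable pos (EFin \o (fun x => p * expR ((p - 1) * ln x - (p + 1) * ln (1 + x)))).
Proof.
move=> p0; set g := fun x => _.
pose E x := expR (p * (ln x - ln (1 + x))).
have x1 x : 0 < x -> 0 < 1 + x by move=> ?; rewrite addr_gt0.
have g0 x : 0 < x -> 0 <= g x by move=> _; rewrite mulr_ge0 ?expR_ge0// ltW.
have dg x : 0 < x ->
    is_derive x 1 g (g x * ((p - 1) / x - (p + 1) / (1 + x))).
  move=> x0; have d1 := is_derive1_ln x0; have d2 := is_derive1_ln (x1 _ x0).
  by apply: is_derive_eq; rewrite /g /GRing.scale /=; ring.
have cg x : 0 < x -> {for x, continuous g}.
  by move=> x0; exact: is_derive_cont (dg _ x0).
have dE x : 0 < x -> is_derive x 1 E (g x).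
  move=> x0; have d1 := is_derive1_ln x0; have d2 := is_derive1_ln (x1 _ x0).
  have -> : g x = expR (p * (ln x - ln (1 + x))) * (p * (x^-1 - (1 + x)^-1)).
    have -> : x^-1 - (1 + x)^-1 = expR (- ln x - ln (1 + x)).
      rewrite expRD !expRN !lnK ?posrE ?x1//; field.
      by rewrite !gt_eqF// x1.
    rewrite mulrCA -expRD; congr (_ * expR _); ring.
  by apply: is_derive_eq; rewrite /GRing.scale /=; ring.
apply/integrableP; split.
  by apply/measurable_EFinP; exact: measurable_fun_pos.
have -> : (\int[mu]_(x in pos) `|(EFin \o g) x| = \int[mu]_(x in pos) (g x)%:E)%E.
  apply: eq_integral => x; rewrite inE/= in_itv/= andbT => x0.
  by rewrite ger0_norm// g0.
rewrite (@ge0_FTC_0y _ g E 0 1)//; first exact: ltry.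
- apply: (squeeze_cvgr _ (cvg_cst 0) (cvg_expR_ln_0 p0)).
  near=> x; rewrite expR_ge0 /= ler_expR ler_pM2l//.
  by rewrite gerBl ln_ge0// lerDl.
(* At infinity [E] lies between 1 - p / x and 1, since exp u >= 1 + u and ln(1 + 1/x) <= 1/x. *)
- have H : 1 - p * x^-1 @[x --> +oo] --> (1 : R).
    rewrite -[X in _ --> X]subr0; apply: cvgB; first exact: cvg_cst.
    rewrite -[X in _ --> X](mulr0 p); apply: cvgM; first exact: cvg_cst.
    apply/gtr0_cvgV0; [exact: nbhs_pinfty_gt|exact: cvg_id].
  apply: (squeeze_cvgr _ H (cvg_cst (1 : R))).
  near=> x; have x0 : 0 < x by [].
  have L : ln (1 + x) - ln x = ln (1 + x^-1).
    rewrite -ln_div ?posrE ?x1//; congr ln; field; by rewrite gt_eqF.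
  rewrite /E -(opprB (ln (1 + x))) L mulrN; apply/andP; split; last first.
    by rewrite expR_le1 oppr_le0 mulr_ge0 ?(ltW p0)// ln_ge0// lerDl invr_ge0 ltW.
  apply: le_trans (expR_ge1Dx _); rewrite lerD2l lerN2 ler_pM2l//.
  by apply: le_ln1Dx; rewrite (lt_trans (ltrN10 _))// invr_gt0.
Unshelve. all: by end_near. Qed.

(** Comparison with the kernel x^(p-1) / (1 + x)^(p+1): it suffices that (p + 1) ln(1 + x) <= k x +
    c. The slope [eps] = k / (p + 1) in [ln_le_lin] gives precisely the coefficient k, and [c]
    collects the constants. *)
Lemma integrable_gamma_kernel p k : 0 < p -> 0 < k ->
  mu.-integrable pos (EFin \o (fun x => expR ((p - 1) * ln x - k * x))).
Proof.
move=> p0 k0; have x1 x : 0 < x -> 0 < 1 + x by move=> ?; rewrite addr_gt0.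
pose eps := k / (p + 1); have e0 : 0 < eps by rewrite divr_gt0// addr_gt0.
pose c := k - (p + 1) * (1 + ln eps).
apply: (le_integrable _ _ _ (integrable_EFinZ (expR c / p) _
  (integrable_beta_kernel p0))) => //.
  apply/measurable_EFinP; apply: measurable_fun_pos => x x0.
  have d1 := is_derive1_ln x0.
  have : is_derive x 1 (fun x => expR ((p - 1) * ln x - k * x))
      (expR ((p - 1) * ln x - k * x) * ((p - 1) / x - k)).
    by apply: is_derive_eq; rewrite /GRing.scale /=; ring.
  exact: is_derive_cont.
move=> x; rewrite /= in_itv/= andbT => x0; rewrite lee_fin.
rewrite mulrA divfK ?gt_eqF// -expRD !ger0_norm ?expR_ge0// ler_expR.
have H := ln_le_lin e0 (x1 _ x0).
have : (p + 1) * (ln eps + ln (1 + x)) <= (p + 1) * (eps * (1 + x) - 1).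
  by rewrite ler_pM2l ?addr_gt0//; lra.
have -> : (p + 1) * (eps * (1 + x) - 1) = k * (1 + x) - (p + 1).
  by rewrite /eps; field; rewrite gt_eqF// addr_gt0.
rewrite /c; lra.
Qed.

End GammaKernel.

(** * Measure-preserving substitutions and Fubini for real convolutions *)

Section RealConvolution.
Variable R : realType.
Notation T := (measurableTypeR R).
Notation mu := (@lebesgue_measure R).
Local Notation mu2 := (mu \x mu)%E.

Section MeasurePreserving.
Variable u : T -> T.
Hypothesis umeas : measurable_fun [set: T] u.
Hypothesis u_mu : forall A : set T, measurable A -> pushforward mu u A = mu A.

Lemma ge0_integral_preserving (f : R -> \bar R) : measurable_fun [set: R] f ->
  (forall x, 0 <= f x)%E -> (\int[mu]_x f (u x) = \int[mu]_x f x)%E.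
Proof.
move=> mf f0.
have := @ge0_integral_pushforward _ _ T T R _ umeas mu setT f.
rewrite preimage_setT => <- //.
by apply: eq_measure_integral => //= A mA AS; exact: u_mu.
Qed.

Lemma integrable_preserving (f : R -> R) :
  mu.-integrable [set: R] (EFin \o f) ->
  mu.-integrable [set: R] (EFin \o (fun x => f (u x))).
Proof.
move=> /integrableP[mf lf]; apply/integrableP; split.
  exact: (measurableT_comp mf umeas).
rewrite (_ : (fun x => _) = (fun x : R => (fun y : R => `|(f y)%:E|%E) (u x)))//.
rewrite (@ge0_integral_preserving (fun y : R => `|(f y)%:E|%E))//.
exact: measurableT_comp.
Qed.

Lemma Rintegral_preserving (f : R -> R) :
  mu.-integrable [set: R] (EFin \o f) ->
  Rintegral mu setT (fun x => f (u x)) = Rintegral mu setT f.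
Proof.
move=> fi; rewrite /Rintegral; congr fine.
have mf := measurable_int mu fi.
have := @integral_pushforward _ _ T T R _ umeas mu setT (EFin \o f) mf.
rewrite preimage_setT => /(_ (integrable_preserving fi)) H.
have E : (\int[mu]_x (f (u x))%:E = \int[mu]_x ((EFin \o f) \o u) x)%E by [].
rewrite E -H //.
by apply: eq_measure_integral => //= A mA AS; exact: u_mu.
Qed.

End MeasurePreserving.

Lemma measurable_subr (c : R) : measurable_fun [set: T] ((fun x => x - c) : T -> T).
Proof. exact: measurable_funB. Qed.

Lemma lebesgue_measure_shift (c : R) (A : set T) : measurable A ->
  pushforward mu ((fun x => x - c) : T -> T) A = mu A.
Proof.
move=> mA; have mf := @measurable_subr c.
apply/esym/lebesgue_measure_unique => //= _ [[a b]] _ <-.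
rewrite /pushforward.
have -> : (fun x : R => x - c) @^-1` `]a, b] = `](a + c), (b + c)]%classic.
  by apply/seteqP; split=> x /=; rewrite !in_itv/= ltrBrDr lerBlDr.
rewrite !lebesgue_measure_itv/= !lte_fin ltrD2r; case: ifPn => // _.
by rewrite -!EFinB; congr EFin; ring.
Qed.

Lemma measurable_rsub (c : R) : measurable_fun [set: T] ((fun x => c - x) : T -> T).
Proof. exact: measurable_funB. Qed.

(** Lebesgue measure is determined by its values on the intervals ]a, b]. Their preimages are closed
    on the other side, [c - b, c - a[, but have the same length. *)
Lemma lebesgue_measure_reflect (c : R) (A : set T) : measurable A ->
  pushforward mu ((fun x => c - x) : T -> T) A = mu A.
Proof.
move=> mA; have mf := @measurable_rsub c.
apply/esym/lebesgue_measure_unique => //= _ [[a b]] _ <-.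
rewrite /pushforward.
have -> : (fun x : R => c - x) @^-1` `]a, b] = `[(c - b), (c - a)[%classic.
  by apply/seteqP; split=> x /=; rewrite !in_itv/= => /andP[h1 h2]; lra.
rewrite !lebesgue_measure_itv/= !lte_fin ltrD2l ltrN2; case: ifPn => // _.
by rewrite -!EFinB; congr EFin; ring.
Qed.

Lemma integrable_fine (f : R -> \bar R) : mu.-integrable setT f ->
  mu.-integrable setT (EFin \o (fine \o f)).
Proof.
move=> fi; have mf := measurable_int mu fi.
apply: le_integrable fi => //.
  by apply/measurable_EFinP; exact: measurableT_comp.
by move=> x _ /=; case: (f x) => [r| |] /=; rewrite ?normr0 ?lexx ?leey.
Qed.

(** The inner integral in Fubini is finite only almost everywhere, whereas [Rintegral] applies
    [fine] at every point; integrability makes the two agree almost everywhere. *)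
Lemma integral_fine (f : R -> \bar R) : mu.-integrable setT f ->
  (\int[mu]_x (fine (f x))%:E = \int[mu]_x f x)%E.
Proof.
move=> fi; have mf := measurable_int mu fi.
apply: ae_eq_integral => //.
  by apply/measurable_EFinP; exact: measurableT_comp.
by apply: filterS (integrable_ae measurableT fi) => x /= h _; rewrite fineK// h.
Qed.

(** Tonelli with x as inner variable: translation invariance turns the inner integral of the
    absolute value into the constant [K] times |h(y)|. *)
Lemma integrable_convolution (k h : R -> R) :
  mu.-integrable setT (EFin \o k) -> mu.-integrable setT (EFin \o h) ->
  mu2.-integrable setT (fun z : T * T => (k (z.1 - z.2) * h z.2)%:E).
Proof.
move=> ki hi.
have mk : measurable_fun [set: T] k by apply/measurable_EFinP; exact: measurable_int ki.
have mh : measurable_fun [set: T] h by apply/measurable_EFinP; exact: measurable_int hi.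
have mF : measurable_fun [set: T * T] (fun z : T * T => (k (z.1 - z.2) * h z.2)%:E).
  apply/measurable_EFinP; apply: measurable_funM.
    apply: (measurableT_comp mk); exact: measurable_funB.
  exact: (measurableT_comp mh).
apply/(integrable21ltyP mu mu mF).
have /integrableP[_ lk] := ki; have /integrableP[_ lh] := hi.
set K := (\int[mu]_x `|(EFin \o k) x|)%E in lk.
have mak : measurable_fun [set: R] (fun x : R => `|(k x)%:E|%E).
  by apply: measurableT_comp => //; exact/measurable_EFinP.
have mah : measurable_fun [set: R] (fun x : R => `|(h x)%:E|%E).
  by apply: measurableT_comp => //; exact/measurable_EFinP.
have E (y : R) : (\int[mu]_x `|(k (x - y)%R * h y)%:E| = K * `|(h y)%:E|)%E.
  under eq_integral do rewrite EFinM abseM.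
  rewrite ge0_integralZr//.
  - by rewrite (ge0_integral_preserving (@measurable_subr y)
      (@lebesgue_measure_shift y) (f := fun x : R => `|(k x)%:E|%E)).
  - exact: (measurableT_comp mak (@measurable_subr y)).
rewrite (eq_integral (fun y : T => (K * `|(h y)%:E|)%E)) => [|y _]; last exact: E.
have K0 : (0 <= K)%E by exact: integral_ge0.
rewrite ge0_integralZl//.
have Kfin : K \is a fin_num by rewrite ge0_fin_numE.
rewrite -(fineK Kfin); apply: lte_mul_pinfty => //.
by rewrite lee_fin fine_ge0.
Qed.

Lemma integrable_Rfubini (f : T * T -> R) : mu2.-integrable setT (EFin \o f) ->
  mu.-integrable setT (EFin \o (fun x => Rintegral mu setT (fun t => f (x, t)))).
Proof. by move=> fi; exact: (integrable_fine (integrable_fubini_F fi)). Qed.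

(** The two sides are treated differently. For fixed [t] the section is assumed integrable, as it is
    for k(x - t) h(t), so [fine] is exact there; for fixed [x] the almost everywhere argument of
    [integral_fine] is used. *)
Lemma Rfubini (f : T * T -> R) : mu2.-integrable setT (EFin \o f) ->
  (forall t, mu.-integrable setT (EFin \o (fun x => f (x, t)))) ->
  Rintegral mu setT (fun x => Rintegral mu setT (fun t => f (x, t))) =
  Rintegral mu setT (fun t => Rintegral mu setT (fun x => f (x, t))).
Proof.
move=> fi fti; rewrite {1}/Rintegral [RHS]/Rintegral; congr fine.
rewrite (integral_fine (integrable_fubini_F fi)).
rewrite [LHS](Fubini fi); apply: eq_integral => t _ /=.
by rewrite fineK//; exact: integrable_fin_num (fti t).
Qed.

End RealConvolution.

(** * The integral of a complex convolution *)

Section ComplexConvolution.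
Variable R : realType.
Local Notation Re := (@complex.Re R).
Local Notation Im := (@complex.Im R).
Notation T := (measurableTypeR R).
Notation mu := (@lebesgue_measure R).
Implicit Types k h : R -> R[i].

Let conv_integrable k h : cintegrable setT k -> cintegrable setT h ->
  (mu \x mu)%E.-integrable setT (EFin \o (fun z : T * T => Re (k (z.1 - z.2) * h z.2))) /\
  (mu \x mu)%E.-integrable setT (EFin \o (fun z : T * T => Im (k (z.1 - z.2) * h z.2))).
Proof.
move=> [k1 k2] [h1 h2]; split.
  have := integrableB measurableT (integrable_convolution k1 h1)
    (integrable_convolution k2 h2).
  by apply: eq_integrable => // z _ /=; rewrite ReM EFinB.
have := integrableD measurableT (integrable_convolution k1 h2) (integrable_convolution k2 h1).
by apply: eq_integrable => // z _ /=; rewrite ImM EFinD.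
Qed.

Lemma cintegrable_convolution k h : cintegrable setT k -> cintegrable setT h ->
  cintegrable setT (fun x => cintegral setT (fun t => k (x - t) * h t)).
Proof.
move=> ki hi; have [c1 c2] := conv_integrable ki hi.
split; [exact: (integrable_Rfubini c1)|exact: (integrable_Rfubini c2)].
Qed.

Lemma cintegral_convolution k h : cintegrable setT k -> cintegrable setT h ->
  cintegral setT (fun x => cintegral setT (fun t => k (x - t) * h t)) =
  cintegral setT k * cintegral setT h.
Proof.
move=> ki hi; have [c1 c2] := conv_integrable ki hi.
have kti t : cintegrable setT (fun x => k (x - t)).
  case: ki => k1 k2; split.
    exact: (integrable_preserving (@measurable_subr R t) (@lebesgue_measure_shift R t) k1).
  exact: (integrable_preserving (@measurable_subr R t) (@lebesgue_measure_shift R t) k2).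
have Fti t : cintegrable setT (fun x => k (x - t) * h t).
  apply: eq_cintegrable (cintegrableZ (h t) measurableT (kti t)) => // x _.
  exact: mulrC.
have -> : cintegral setT (fun x => cintegral setT (fun t => k (x - t) * h t)) =
    cintegral setT (fun t => cintegral setT (fun x => k (x - t) * h t)).
  apply: complexP.
    exact: (@Rfubini R (fun z => Re (k (z.1 - z.2) * h z.2)) c1 (fun t => (Fti t).1)).
  exact: (@Rfubini R (fun z => Im (k (z.1 - z.2) * h z.2)) c2 (fun t => (Fti t).2)).
rewrite -cintegralZ//; apply: eq_cintegral => t _.
under [LHS]eq_cintegral do rewrite mulrC.
rewrite cintegralZ// mulrC; congr (_ * _).
case: ki => k1 k2; apply: complexP.
  exact: (Rintegral_preserving (@measurable_subr R t) (@lebesgue_measure_shift R t) k1).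
exact: (Rintegral_preserving (@measurable_subr R t) (@lebesgue_measure_shift R t) k2).
Qed.

End ComplexConvolution.

(** * The Gamma function and its non-vanishing *)

Section Gamma.
Variable R : realType.
Local Notation Re := (@complex.Re R).
Local Notation Im := (@complex.Im R).
Notation mu := (@lebesgue_measure R).
Local Notation pos := (`](0 : R)%R, +oo[%classic).
Implicit Types (a s z : R[i]) (x y t p k : R).

(** This is t^(a-1) exp(-s t) for t > 0, written as one exponential so that its modulus and
    derivative are immediate. *)
Definition gamma_kernel a s t : R[i] := cexp ((a - 1) * (ln t)%:C - s * t%:C).

Definition laplace_power a s := cintegral pos (gamma_kernel a s).

Lemma cmod_gamma_kernel a s t :
  cmod (gamma_kernel a s t) = expR ((Re a - 1) * ln t - Re s * t).
Proof. by rewrite cmod_cexp; congr expR; rewrite !ReImE; ring. Qed.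

Lemma is_cder_gamma_kernel a s t : 0 < t ->
  is_cder (gamma_kernel a s) t (gamma_kernel a s t * ((a - 1) * (t^-1)%:C - s)).
Proof.
move=> t0; have d1 := is_derive1_ln t0; apply: is_cder_cexp.
apply: is_cder_eq.
  apply: is_cderD.
    by apply: is_cderM; [exact: is_cder_cst|exact: is_cderC d1].
  rewrite (_ : (fun x => - (s * x%:C)) = (fun x => (- s) * x%:C)); last first.
    by apply/funext => x; rewrite mulNr.
  by apply: is_cderM; [exact: is_cder_cst|exact: is_cderC (is_derive_id _ _)].
by rewrite !mul0r !add0r mulr1.
Qed.

Lemma ccont_gamma_kernel a s t : 0 < t -> ccont (gamma_kernel a s) t.
Proof. by move=> t0; exact: is_cder_cont (is_cder_gamma_kernel a s t0). Qed.

Lemma cintegrable_gamma_kernel a s :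
  0 < Re a -> 0 < Re s -> cintegrable pos (gamma_kernel a s).
Proof.
move=> a0 s0; apply: le_cintegrable (integrable_gamma_kernel a0 s0) _ => //.
  by apply: ccont_cmfun => t t0; exact: ccont_gamma_kernel.
by move=> t _; rewrite cmod_gamma_kernel.
Qed.

Lemma gamma_kernelS a s t : 0 < t -> gamma_kernel (a + 1) s t = t%:C * gamma_kernel a s t.
Proof.
move=> t0; have tE : t%:C = cexp (ln t)%:C by rewrite cexpC lnK.
by rewrite [X in X * _]tE -cexpD; congr cexp; ring.
Qed.

(** Half of the decay pays for the power: [q] is a positive bound of [p], and the slope [e] = k / (2
    q) in [ln_le_lin] gives q ln t <= k t / 2 + c, which leaves exp(c - k t / 2). *)
Lemma cvg_expR_ln_y p k : 0 < k -> expR (p * ln t - k * t) @[t --> +oo] --> (0 : R).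
Proof.
move=> k0; pose q := `|p| + 1; have q0 : 0 < q by rewrite ltr_wpDl.
pose e := k / (2 * q); have e0 : 0 < e by rewrite divr_gt0// mulr_gt0.
pose c := q * (- 1 - ln e).
have H : expR c * expR (- (t * (k / 2))) @[t --> +oo] --> (0 : R).
  rewrite -[X in _ --> X](mulr0 (expR c)); apply: cvgM; first exact: cvg_cst.
  have ty : t * (k / 2) @[t --> +oo] --> (+oo : set_system R).
    by apply: gt0_cvgMly; [rewrite divr_gt0|exact: cvg_id].
  exact: cvg_comp _ _ ty (@cvgr_expR R).
apply: (squeeze_cvgr _ (cvg_cst (0 : R)) H); near=> t.
have t1 : 1 <= t by near: t; exact: nbhs_pinfty_ge.
have t0 : 0 < t by rewrite (lt_le_trans ltr01).
rewrite expR_ge0 /= -expRD ler_expR.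
have h1 : p * ln t <= q * ln t.
  by rewrite ler_wpM2r ?ln_ge0// (le_trans (ler_norm p))// lerDl.
have h2 : q * ln t <= q * (e * t - 1 - ln e) by rewrite ler_pM2l// ln_le_lin.
have h3 : q * (e * t - 1 - ln e) = k / 2 * t + c.
  by rewrite /c /e; field; rewrite gt_eqF.
lra.
Unshelve. all: by end_near. Qed.

Lemma ccvg_gamma_kernelS_0 a s : 0 < Re a -> 0 < Re s -> ccvg 0^'+ (gamma_kernel (a + 1) s) 0.
Proof.
move=> a0 s0; apply: ccvg_cmod0 (cvg_expR_ln_0 a0); near=> t.
have t0 : 0 < t by [].
rewrite cmod_gamma_kernel !ReImE addrK ler_expR gerBl mulr_ge0// ltW//.
Unshelve. all: by end_near. Qed.

Lemma ccvg_gamma_kernel_y a s : 0 < Re s -> ccvg +oo (gamma_kernel a s) 0.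
Proof.
move=> s0; apply: ccvg_cmod0 (cvg_expR_ln_y (Re a - 1) s0).
by near=> t; rewrite cmod_gamma_kernel.
Unshelve. all: by end_near. Qed.

(** Integrate the derivative of t^a exp(-s t), whose limits at 0+ and at infinity are both 0. *)
Lemma laplace_power_rec a s : 0 < Re a -> 0 < Re s ->
  s * laplace_power (a + 1) s = a * laplace_power a s.
Proof.
move=> a0 s0.
have a1 : 0 < Re (a + 1) by rewrite !ReImE addr_gt0.
have i1 := cintegrable_gamma_kernel a0 s0; have i2 := cintegrable_gamma_kernel a1 s0.
pose g t := a * gamma_kernel a s t + (- s) * gamma_kernel (a + 1) s t.
have ig : cintegrable pos g by apply: cintegrableD => //; exact: cintegrableZ.
have dg t : 0 < t -> is_cder (gamma_kernel (a + 1) s) t (g t).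
  move=> t0; apply: is_cder_eq (is_cder_gamma_kernel _ _ t0) _.
  rewrite /g mulrBr mulNr [_ * s]mulrC; congr (_ - _).
  rewrite gamma_kernelS// addrK mulrC mulrA -[a * _ * _]mulrA -rmorphM mulVf ?gt_eqF//.
  by rewrite mulr1.
have := cFTC_0y dg _ ig (ccvg_gamma_kernelS_0 a0 s0) (ccvg_gamma_kernel_y _ s0).
rewrite subr0 cintegralD//; [|exact: cintegrableZ|exact: cintegrableZ].
rewrite !cintegralZ// mulNr => /(_ _)/eqP; rewrite subr_eq0 => /(_ _)/eqP ->//.
move=> t t0; apply: ccvgD; apply: ccvgM; try exact: ccvg_cst; exact: ccont_gamma_kernel.
Qed.

Lemma cGammaE a : cGamma a = laplace_power a 1.
Proof.
apply: eq_cintegral => t; rewrite inE/= in_itv/= andbT => t0.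
by rewrite /cpow clogC// -cexpC -cexpD /gamma_kernel mul1r rmorphN.
Qed.

Definition real_gamma_kernel p t := expR ((p - 1) * ln t - t).

Lemma gamma_kernel_real p t : gamma_kernel p%:C 1 t = (real_gamma_kernel p t)%:C.
Proof.
by rewrite -cexpC /gamma_kernel mul1r; congr cexp; rewrite -(rmorph1 (real_complex R))
  -!(rmorphM, rmorphB).
Qed.

Lemma integrable_real_gamma_kernel p :
  0 < p -> mu.-integrable pos (EFin \o real_gamma_kernel p).
Proof.
move=> p0; have := integrable_gamma_kernel p0 ltr01.
by apply: eq_integrable => // t _ /=; rewrite mul1r.
Qed.

Definition rGamma p := Rintegral mu pos (real_gamma_kernel p).

Lemma laplace_power_real p : Re (laplace_power p%:C 1) = rGamma p.
Proof. by apply: eq_Rintegral => t _; rewrite /comp gamma_kernel_real. Qed.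

Lemma rGammaS p : 0 < p -> rGamma (p + 1) = p * rGamma p.
Proof.
move=> p0; have := @laplace_power_rec p%:C 1 p0 ltr01; rewrite mul1r.
move=> /(congr1 (@complex.Re R)); rewrite ReM ReC ImC mul0r subr0 laplace_power_real => <-.
by rewrite -laplace_power_real rmorphD rmorph1.
Qed.

Lemma rGamma_gt0 p : 1 <= p -> 0 < rGamma p.
Proof.
move=> p1; have p0 : 0 < p by rewrite (lt_le_trans ltr01).
have ip := integrable_real_gamma_kernel p0.
(* On [1, 2], an interval of length 1, the kernel is at least exp(-2), because (p - 1) ln t >= 0 and
   t <= 2. *)
apply: (@lt_le_trans _ _ (expR (- 2))); first exact: expR_gt0.
rewrite -lee_fin /rGamma /Rintegral fineK; last exact: integrable_fin_num.
have -> : (expR (- 2))%:E = (\int[mu]_(x in `[(1 : R)%R, 2%R]) (expR (- 2))%:E)%E.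
  rewrite integral_cst//= lebesgue_measure_itv/= lte_fin ltr1n.
  by rewrite -EFinB -EFinM; congr EFin; lra.
have s12 : `[(1 : R), 2] `<=` pos.
  by move=> x /=; rewrite !in_itv/= andbT => /andP[+ _]; apply: lt_le_trans.
apply: (@le_trans _ _ (\int[mu]_(x in `[(1 : R)%R, 2%R]) (real_gamma_kernel p x)%:E)%E).
  apply: ge0_le_integral => //.
  - by apply: measurable_funS s12 _ => //; exact: measurable_int ip.
  move=> x; rewrite /= in_itv/= => /andP[x1 x2]; rewrite lee_fin ler_expR.
  rewrite -[leLHS]add0r; apply: lerD; last by rewrite lerN2.
  by rewrite mulr_ge0 ?ln_ge0// subr_ge0.
apply: ge0_subset_integral => //; first exact: measurable_int ip.
by move=> x _; rewrite lee_fin expR_ge0.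
Qed.

Lemma norm_sin_le x : `|sin x| <= `|x|.
Proof.
wlog x0 : x / 0 <= x.
  move=> H; have [|/ltW x0] := leP 0 x; first exact: H.
  by rewrite -(normrN x) -(normrN (sin x)) -sinN; apply: H; rewrite oppr_ge0.
have cs : {within `[0, x], continuous sin}.
  by apply: continuous_subspaceT => y; exact: continuous_sin.
have [c _] := MVT_segment x0 (fun y _ => is_derive_sin y) cs.
by rewrite sin0 !subr0 => ->; rewrite normrM ler_piMl// cos_max.
Qed.

Lemma cos_ge_quad x : 1 - x ^+ 2 / 2 <= cos x.
Proof.
have -> : cos x = 1 - sin (x / 2) ^+ 2 *+ 2.
  have {1}-> : x = (x / 2) *+ 2 by lra.
  by rewrite cos_mulr2n sin2cos2; ring.
have := norm_sin_le (x / 2); rewrite -(@ler_pXn2r _ 2)// ?nnegrE//.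
rewrite !real_normK ?num_real//; lra.
Qed.

(** The bracket is (exp(x/2) - exp(-x/2))^2, and for x >= 0 the base is at least x/2. With x
    replaced by ln(t/x), the right side involves only t/x and x/t, whose Gamma means are explicit,
    unlike that of a squared logarithm. *)
Lemma sqr_le_cosh x : x ^+ 2 <= 4 * (expR x + expR (- x) - 2).
Proof.
wlog x0 : x / 0 <= x.
  move=> H; have [|/ltW x0] := leP 0 x; first exact: H.
  have := H (- x); rewrite opprK sqrrN oppr_ge0 => /(_ x0); lra.
have e1 : expR x = expR (x / 2) ^+ 2 by rewrite -expRM_natl; congr expR; lra.
have e2 : expR (- x) = expR (- (x / 2)) ^+ 2.
  by rewrite -expRM_natl; congr expR; lra.
have e3 : expR (x / 2) * expR (- (x / 2)) = 1 by rewrite -expRD subrr expR0.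
have h1 : 1 + x / 2 <= expR (x / 2) by exact: expR_ge1Dx.
have h2 : expR (- (x / 2)) <= 1 by rewrite expR_le1; lra.
have h3 : 0 <= x / 2 <= expR (x / 2) - expR (- (x / 2)) by lra.
have : (x / 2) ^+ 2 <= (expR (x / 2) - expR (- (x / 2))) ^+ 2.
  by apply: lerXn2r; rewrite ?nnegrE; lra.
rewrite sqrrB e1 e2 e3; lra.
Qed.

(* E(ln(t/x)^2) = O(1/x) under the Gamma law of mean x, so t^{iy} is close to
   x^{iy} in the mean when x is large compared to y^2. *)
Lemma laplace_power_large_neq0 a : 2 * Im a ^+ 2 < Re a - 1 -> laplace_power a 1 != 0.
Proof.
set x := Re a; set y := Im a => xy.
have x1 : 1 < x by rewrite -subr_gt0 (le_lt_trans _ xy)// mulr_ge0// sqr_ge0.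
have x0 : 0 < x by rewrite (lt_trans ltr01).
have xm : 0 < x - 1 by rewrite subr_gt0.
have a0 : 0 < Re a by [].
have ia := @cintegrable_gamma_kernel a 1 a0 ltr01.
have [c [cr ci]] : exists c : R[i], Re c = 0 /\ Im c = - y by exists (0 +i* (- y)).
(* The rotation x^(-iy): it turns t^(iy) into (t/x)^(iy), so the real part of the integrand becomes
   the real kernel times cos(y ln(t/x)). *)
pose w : R[i] := cexp (c * (ln x)%:C).
apply/negP => /eqP phi0.
have : Re (w * laplace_power a 1) = 0 by rewrite phi0 mulr0.
rewrite /laplace_power -cintegralZ//=; apply/eqP; rewrite gt_eqF//.
have iw := cintegrableZ w (measurable_itv _) ia.
(* This is the real kernel times t/x + x/t. Then [f] is the minorant given by cos(y v) >= 1 - y^2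
   v^2 / 2 and [sqr_le_cosh], with v = ln(t/x). *)
pose q t := x^-1 * real_gamma_kernel (x + 1) t + x * real_gamma_kernel (x - 1) t.
pose f t := real_gamma_kernel x t -
  (2 * y ^+ 2) * (q t - 2 * real_gamma_kernel x t).
have j1 := integrable_real_gamma_kernel x0.
have j2 := integrable_real_gamma_kernel (ltr_wpDr ler01 x0 : 0 < x + 1).
have j3 := integrable_real_gamma_kernel xm.
have j4 : mu.-integrable pos (EFin \o q).
  by apply: integrable_EFinD => //; exact: integrable_EFinZ.
have j5 : mu.-integrable pos
    (EFin \o (fun t => q t - 2 * real_gamma_kernel x t)).
  by apply: integrable_EFinB => //; exact: integrable_EFinZ.
have j6 := integrable_EFinZ (2 * y ^+ 2) (measurable_itv _) j5.
have jf : mu.-integrable pos (EFin \o f) by exact: integrable_EFinB.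
(* Under the Gamma law t/x has mean 1 and x/t has mean x / (x - 1), so t/x + x/t - 2 has mean 1 / (x
   - 1). The hypothesis on [a] is positivity of this value. *)
have fE : Rintegral mu pos f = rGamma x * (1 - 2 * y ^+ 2 / (x - 1)).
  rewrite /f RintegralB// RintegralZl// RintegralB//; last exact: integrable_EFinZ.
  rewrite /q RintegralD//; [|exact: integrable_EFinZ|exact: integrable_EFinZ].
  rewrite !RintegralZl// -!/(rGamma _) rGammaS//.
  have := rGammaS xm; rewrite subrK => ->.
  by field; rewrite !gt_eqF.
apply: (@lt_le_trans _ _ (Rintegral mu pos f)).
  rewrite fE mulr_gt0//; first by apply: rGamma_gt0; exact: ltW.
  by rewrite subr_gt0 ltr_pdivrMr// mul1r.
apply: le_Rintegral => //; first by case: iw.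
move=> t tpos; have t0 : 0 < t by move: tpos; rewrite /= in_itv/= andbT.
suff : f t <= Re (w * gamma_kernel a 1 t) by [].
have -> : Re (w * gamma_kernel a 1 t) = real_gamma_kernel x t * cos (y * (ln t - ln x)).
  rewrite -cexpD Re_cexp; congr (expR _ * cos _); rewrite !ReImE cr ci -/x -/y.
    ring.
  ring.
set v := ln t - ln x.
have r1 : x^-1 * real_gamma_kernel (x + 1) t = real_gamma_kernel x t * expR v.
  by rewrite -expRD -{1}(lnK x0) -expRN -expRD; congr expR; rewrite /v; ring.
have r2 : x * real_gamma_kernel (x - 1) t = real_gamma_kernel x t * expR (- v).
  by rewrite -expRD -{1}(lnK x0) -expRD; congr expR; rewrite /v; ring.
rewrite /f /q r1 r2.
have g0 : 0 <= real_gamma_kernel x t by exact: expR_ge0.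
have h1 := cos_ge_quad (y * v); have h2 := sqr_le_cosh v.
have h3 : y ^+ 2 * v ^+ 2 <= y ^+ 2 * (4 * (expR v + expR (- v) - 2)).
  by rewrite ler_wpM2l// sqr_ge0.
have h4 : 1 - 2 * y ^+ 2 * (expR v + expR (- v) - 2) <= cos (y * v).
  by apply: le_trans h1; rewrite exprMn; lra.
have := ler_wpM2l g0 h4; lra.
Qed.

Lemma laplace_power_eq0_addn a n :
  0 < Re a -> laplace_power a 1 = 0 -> laplace_power (a + n%:R) 1 = 0.
Proof.
move=> a0 h; elim: n => [|n ih]; first by rewrite addr0.
rewrite -addn1 natrD addrA -[LHS]mul1r laplace_power_rec ?ih ?mulr0//.
by rewrite !ReImE ltr_wpDr.
Qed.

Lemma cGamma_neq0 a : 0 < Re a -> cGamma a != 0.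
Proof.
move=> a0; rewrite cGammaE; apply/negP => /eqP h.
have [n nP] : exists n : nat, 2 * Im a ^+ 2 + 1 - Re a < n%:R.
  by exists (Num.truncn (2 * Im a ^+ 2 + 1 - Re a)).+1; rewrite truncnS_gt.
have := @laplace_power_large_neq0 (a + n%:R); rewrite laplace_power_eq0_addn// eqxx.
by rewrite !ReImE addr0 => H; have := H _; rewrite /=; case/implyP; apply/negP; lra.
Qed.

End Gamma.

(** * The Laplace transform of a power for complex s *)

Section GammaLaplace.
Variable R : realType.
Local Notation Re := (@complex.Re R).
Local Notation Im := (@complex.Im R).
Notation mu := (@lebesgue_measure R).
Local Notation pos := (`](0 : R)%R, +oo[%classic).
Implicit Types (a s z : R[i]) (x y t p k th : R).

Lemma is_derive_Rintegral (D : set R) u v (th : R) (f df : R -> R -> R) (G : R -> R) :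
  `]u, v[%classic th -> measurable D ->
  (forall x t, `]u, v[%classic x -> D t -> is_derive x 1 (f ^~ t) (df x t)) ->
  (forall x, `]u, v[%classic x -> mu.-integrable D (EFin \o f x)) ->
  (forall t, 0 <= G t) -> mu.-integrable D (EFin \o G) ->
  (forall x t, `]u, v[%classic x -> D t -> `|df x t| <= G t) ->
  is_derive th 1 (fun x => Rintegral mu D (f x)) (Rintegral mu D (df th)).
Proof.
move=> Ith mD fd fi G0 iG dG.
have pE x t : `]u, v[%classic x -> D t -> partial1of2 f x t = df x t.
  by move=> Ix Dt; rewrite partial1of2E; have [_ e] := fd x t Ix Dt; exact: e.
have fd' x t : `]u, v[%classic x -> D t -> derivable (f ^~ t) x 1.
  by move=> Ix Dt; have [] := fd x t Ix Dt.
have pG x t : `]u, v[%classic x -> D t -> `|partial1of2 f x t| <= G t.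
  by move=> Ix Dt; rewrite pE// dG.
have dI := @derivable_under_integral R _ _ mu f D mD th u v Ith fi fd' G G0 iG pG.
have eI := @differentiation_under_integral R _ _ mu f D mD th u v Ith fi fd' G G0 iG pG.
apply: DeriveDef; first exact: dI.
rewrite -derive1E eI; apply: eq_Rintegral => t /set_mem Dt; exact: pE.
Qed.

Lemma clog_Im s : Im (clog s) = carg s. Proof. by []. Qed.

(** Differentiating in theta on all of [0, 1] requires an open interval around it; [B] bounds such
    an interval and still keeps theta times the argument below pi/2. *)
Lemma exists_pihalf_bound p : `|p| < pi / 2 ->
  exists B : R, [/\ 1 < B & `|p| * B < pi / 2].
Proof.
move=> p2; have p0 := normr_ge0 p; have h : 0 < `|p| + pi / 2 by lra.
exists (pi / (`|p| + pi / 2)); split; first by rewrite ltr_pdivlMr//; lra.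
rewrite mulrA ltr_pdivrMr//; have := pi_gt0 R; nra.
Qed.

(* The integrand of s^a laplace_power(a, s) along s = exp(theta L), L = log s0. *)
Let F a (L : R[i]) th t : R[i] := cexp (a * (th%:C * L)) * gamma_kernel a (cexp (th%:C * L)) t.

(** The first term differentiates the factor s^a. The second differentiates exp(-s t), whose extra
    factor t raises the parameter of the kernel from a to a + 1. *)
Let dF a (L : R[i]) th t : R[i] :=
  L * cexp (a * (th%:C * L)) *
  (a * gamma_kernel a (cexp (th%:C * L)) t -
   cexp (th%:C * L) * gamma_kernel (a + 1) (cexp (th%:C * L)) t).

Let is_cder_F a L th t : 0 < t -> is_cder (F a L ^~ t) th (dF a L th t).
Proof.
move=> t0.
have d0 : is_cder (fun th => th%:C * L) th L.
  apply: is_cder_eq.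
    by apply: is_cderM; [exact: is_cderC (is_derive_id _ _)|exact: is_cder_cst].
  by rewrite mul1r mulr0 addr0.
have d1 : is_cder (fun th => cexp (th%:C * L)) th (cexp (th%:C * L) * L).
  exact: is_cder_cexp.
have d2 : is_cder (fun th => cexp (a * (th%:C * L))) th (cexp (a * (th%:C * L)) * (a * L)).
  apply: is_cder_cexp; apply: is_cder_eq.
    by apply: is_cderM; [exact: is_cder_cst|exact: d0].
  by rewrite mul0r add0r.
have d3 : is_cder (fun th => gamma_kernel a (cexp (th%:C * L)) t) th
    (gamma_kernel a (cexp (th%:C * L)) t * (- (cexp (th%:C * L) * L * t%:C))).
  apply: is_cder_cexp; apply: is_cder_eq.
    apply: is_cderD; first exact: is_cder_cst.
    rewrite (_ : (fun th => _) = (fun th : R => cexp (th%:C * L) * (- t%:C))); last first.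
      by apply/funext => x; rewrite mulrN.
    by apply: is_cderM; [exact: d1|exact: is_cder_cst].
  by rewrite mulr0 addr0 add0r mulrN.
apply: is_cder_eq; first exact: is_cderM d2 d3.
by rewrite /dF gamma_kernelS//; ring.
Qed.

Lemma laplace_powerE a s : 0 < Re a -> 0 < Re s -> laplace_power a s = cGamma a * cpow s (- a).
Proof.
move=> a0 s0; have [L LE] : exists L, L = clog s by exists (clog s).
have s_neq0 : s != 0 by apply: contraTneq s0 => ->; rewrite ltxx.
have [B [B1 BL]] := exists_pihalf_bound (carg_Re_gt0 s0); rewrite -clog_Im -LE in BL.
have B0 : 0 < B by rewrite (lt_trans ltr01).
pose l : R := `|Re L|; pose m : R := `|Im L|.
(* A uniform positive lower bound of Re exp(theta L) = exp(theta Re L) cos(theta Im L) for |theta| <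
   B; it supplies the common decay rate of the majorant. *)
pose kap := expR (- (l * B)) * cos (m * B).
have mB0 : 0 <= m * B by apply: mulr_ge0; [exact: normr_ge0|exact: ltW].
have kap0 : 0 < kap.
  by rewrite mulr_gt0 ?expR_gt0// cos_gt0_pihalf// BL andbT; have := pi_gt0 R; lra.
have bnd (c th : R) : `]-B, B[%classic th -> `|th * c| <= `|c| * B.
  rewrite /= in_itv/= => /andP[h1 h2]; rewrite normrM mulrC ler_wpM2l//.
  by rewrite ler_norml !ltW.
have Rs th : `]-B, B[%classic th -> kap <= Re (cexp (th%:C * L)).
  move=> Ith; rewrite Re_cexp !ReImE mul0r subr0 mul0r addr0.
  apply: ler_pM; rewrite ?expR_ge0//.
  - by apply: cos_ge0_pihalf; have := pi_gt0 R; move: BL; rewrite -/m; lra.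
  - by rewrite ler_expR lerNl; apply: le_trans (bnd (Re L) _ Ith); rewrite -normrN ler_norm.
  rewrite -(cos_norm (th * _)) leNgt ltr_cos ?in_itv/=; last 2 first.
  - by rewrite mB0/=; move: BL; rewrite -/m; have := pi_gt0 R; lra.
  - by rewrite normr_ge0/= (le_trans (bnd (Im L) _ Ith))//; move: BL; rewrite -/m; have := pi_gt0 R; lra.
  by rewrite -leNgt; exact: bnd.
have Rs0 th : `]-B, B[%classic th -> 0 < Re (cexp (th%:C * L)).
  by move=> /Rs; exact: lt_le_trans.
have a10 : 0 < Re (a + 1) by rewrite !ReImE addr_gt0.
have iF th : `]-B, B[%classic th -> cintegrable pos (F a L th).
  by move=> Ith; apply: cintegrableZ => //; apply: cintegrable_gamma_kernel => //; exact: Rs0.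
(* The integrals of the two terms of [dF] cancel by [laplace_power_rec] at the point exp(theta
   L). *)
have i0 th : `]-B, B[%classic th -> cintegral pos (dF a L th) = 0.
  move=> Ith; have sth := Rs0 _ Ith.
  have j1 := cintegrableZ a (measurable_itv _) (cintegrable_gamma_kernel a0 sth).
  have j2 := cintegrableZ (- cexp (th%:C * L)) (measurable_itv _)
    (cintegrable_gamma_kernel a10 sth).
  rewrite /dF cintegralZ//; last first.
    by apply: eq_cintegrable (cintegrableD _ j1 j2) => // t _; rewrite mulNr.
  rewrite (eq_cintegral (h := fun t => a * gamma_kernel a (cexp (th%:C * L)) t +
    (- cexp (th%:C * L)) * gamma_kernel (a + 1) (cexp (th%:C * L)) t)); last first.
    by move=> t _; rewrite mulNr.
  rewrite cintegralD// !cintegralZ//; [|exact: cintegrable_gamma_kernel|exact: cintegrable_gamma_kernel].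
  have rec := laplace_power_rec a0 sth; rewrite /laplace_power in rec.
  by rewrite mulNr rec subrr mulr0.
pose C1 := expR (cmod a * cmod L * B).
pose C2 := cmod L * C1 * cmod a; pose C3 := cmod L * C1 * expR (l * B).
(* One summand for each term of [dF]: [C1] bounds |exp(a theta L)|, and [expR (l * B)] bounds
   |exp(theta L)|. *)
pose G t := C2 * expR ((Re a - 1) * ln t - kap * t) +
  C3 * expR ((Re a + 1 - 1) * ln t - kap * t).
have C10 : 0 <= C1 by exact: expR_ge0.
have G0 t : 0 <= G t.
  by rewrite addr_ge0// !mulr_ge0 ?cmod_ge0 ?expR_ge0.
have iG : mu.-integrable pos (EFin \o G).
  apply: integrable_EFinD => //; apply: integrable_EFinZ => //;
  apply: integrable_gamma_kernel => //; by rewrite addr_gt0.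
have dFG th t : `]-B, B[%classic th -> pos t -> cmod (dF a L th t) <= G t.
  move=> Ith; rewrite /= in_itv/= andbT => t0.
  have gkb b : cmod (gamma_kernel b (cexp (th%:C * L)) t) <= expR ((Re b - 1) * ln t - kap * t).
    by rewrite cmod_gamma_kernel ler_expR lerD2l lerN2 ler_pM2r// Rs.
  have eb : cmod (cexp (a * (th%:C * L))) <= C1.
    rewrite cmod_cexp ler_expR (le_trans (ler_norm _))//.
    rewrite (le_trans (normRe_cmod _))// !cmodM cmodC mulrCA mulrC ler_wpM2l//.
      by rewrite mulr_ge0// cmod_ge0.
    by move: Ith; rewrite /= in_itv/= => /andP[h1 h2]; rewrite ler_norml !ltW.
  have es : cmod (cexp (th%:C * L)) <= expR (l * B).
    rewrite cmod_cexp ler_expR ReM ImC mul0r subr0.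
    by apply: le_trans (bnd _ _ Ith); rewrite ReC ler_norm.
  have -> : G t = cmod L * C1 * (cmod a * expR ((Re a - 1) * ln t - kap * t) +
      expR (l * B) * expR ((Re (a + 1) - 1) * ln t - kap * t)).
    by rewrite /G /C2 /C3 !ReImE; ring.
  rewrite /dF !cmodM; apply: ler_pM; rewrite ?mulr_ge0 ?cmod_ge0//.
    by rewrite ler_wpM2l ?cmod_ge0.
  apply: (le_trans (cmodD _ _)); rewrite cmodN !cmodM; apply: lerD.
    by rewrite ler_wpM2l ?cmod_ge0.
  by apply: ler_pM; rewrite ?cmod_ge0.
have B01 : `[0, 1]%classic `<=` `]-B, B[%classic.
  by move=> th /=; rewrite !in_itv/= => /andP[h1 h2]; lra.
have dE th t : pos t -> is_cder (F a L ^~ t) th (dF a L th t).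
  by rewrite /= in_itv/= andbT; exact: is_cder_F.
have dI th : `]-B, B[%classic th -> is_cder (fun th => cintegral pos (F a L th)) th 0.
  move=> Ith; have e0 := i0 _ Ith; split.
    rewrite -[X in is_derive _ _ _ (Re X)]e0.
    apply: (@is_derive_Rintegral pos _ _ _ (fun th t => Re (F a L th t))
      (fun th t => Re (dF a L th t)) G Ith).
    - exact: measurable_itv.
    - by move=> u t _ /(dE u)[].
    - by move=> u /iF[].
    - exact: G0.
    - exact: iG.
    - by move=> u t Iu tp; rewrite (le_trans (normRe_cmod _))// dFG.
  rewrite -[X in is_derive _ _ _ (Im X)]e0.
  apply: (@is_derive_Rintegral pos _ _ _ (fun th t => Im (F a L th t))
    (fun th t => Im (dF a L th t)) G Ith).
  - exact: measurable_itv.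
  - by move=> u t _ /(dE u)[].
  - by move=> u /iF[].
  - exact: G0.
  - exact: iG.
  - by move=> u t Iu tp; rewrite (le_trans (normIm_cmod _))// dFG.
have cst01 (f : R -> R) : (forall th, `]-B, B[%classic th -> is_derive th 1 f 0) -> f 1 = f 0.
  move=> df.
  have cf : {within `[0, 1], continuous f}.
    by apply: derivable_within_continuous => th /B01 /df[].
  have df' th : th \in `]0, 1[ -> is_derive th 1 f 0.
    move=> h; apply/df/B01; rewrite /=; exact: subset_itv_oo_cc h.
  have [c _] := MVT_segment ler01 df' cf.
  by rewrite mul0r => /eqP; rewrite subr_eq0 => /eqP.
(* The end theta = 1 is s^a times the transform at s; the end theta = 0 is Gamma(a). *)
have : cintegral pos (F a L 1) = cintegral pos (F a L 0).
  by apply: complexP; apply: (cst01 (fun th => _ (cintegral pos (F a L th)))) => th /dI[].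
have E1 : cexp (1%:C * L) = s by rewrite rmorph1 mul1r LE cexp_clog.
have E0 : cexp (0%:C * L) = 1 by rewrite rmorph0 mul0r cexp0.
have g1 : cintegrable pos (gamma_kernel a s) by exact: cintegrable_gamma_kernel.
have g0 : cintegrable pos (gamma_kernel a 1) by exact: cintegrable_gamma_kernel.
rewrite /F E1 E0 (cintegralZ _ _ g1)// (cintegralZ _ _ g0)//.
rewrite rmorph1 rmorph0 mul0r mulr0 cexp0 !mul1r cGammaE /laplace_power => <-.
rewrite cpowN /cpow -LE mulrAC divff ?mul1r//; exact: cexp_neq0.
Qed.

End GammaLaplace.

(** * The Laplace transform of a convolution with a power *)

Section ConvolutionLaplace.
Variable R : realType.
Local Notation Re := (@complex.Re R).
Local Notation Im := (@complex.Im R).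
Notation mu := (@lebesgue_measure R).
Local Notation pos := (`](0 : R)%R, +oo[%classic).
Implicit Types (a s z : R[i]) (x y t p k c M : R) (g h : R -> R[i]).

Lemma cintegrable_supp (D : set R) g : measurable D ->
  (forall x, ~ D x -> g x = 0) -> cintegrable D g <-> cintegrable setT g.
Proof.
move=> mD g0.
have E1 : (EFin \o (Re \o g)) \_ D = EFin \o (Re \o g).
  apply/funext => x; rewrite patchE; case: ifPn => //.
  by rewrite notin_setE => /g0 /= ->.
have E2 : (EFin \o (Im \o g)) \_ D = EFin \o (Im \o g).
  apply/funext => x; rewrite patchE; case: ifPn => //.
  by rewrite notin_setE => /g0 /= ->.
split=> -[i1 i2]; split.
- by have := (@integrable_mkcond _ _ R mu D (EFin \o (Re \o g)) mD).1 i1; rewrite E1.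
- by have := (@integrable_mkcond _ _ R mu D (EFin \o (Im \o g)) mD).1 i2; rewrite E2.
- by apply/(@integrable_mkcond _ _ R mu D (EFin \o (Re \o g)) mD); rewrite E1.
- by apply/(@integrable_mkcond _ _ R mu D (EFin \o (Im \o g)) mD); rewrite E2.
Qed.

Lemma cintegral_supp (D : set R) g : 
  (forall x, ~ D x -> g x = 0) -> cintegral D g = cintegral setT g.
Proof.
move=> g0; apply: complexP => /=; rewrite Rintegral_mkcond; apply: eq_Rintegral => x _;
  rewrite patchE; case: ifPn => //; by rewrite notin_setE => /g0 /= ->.
Qed.

(** Extension by zero makes the convolution over [0, x] one over the whole line, where translation
    invariance is available. *)
Definition zext g t : R[i] := if 0 < t then g t else 0.

Lemma cintegrable_zext g : cintegrable pos g -> cintegrable setT (zext g).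
Proof.
move=> gi; apply/(@cintegrable_supp pos) => //.
  by move=> x /=; rewrite in_itv/= andbT /zext => /negP/negbTE ->.
apply: eq_cintegrable gi => // x; rewrite inE/= in_itv/= andbT => x0.
by rewrite /zext x0.
Qed.

Lemma cintegral_zext g : cintegral setT (zext g) = cintegral pos g.
Proof.
rewrite -(@cintegral_supp pos).
  by apply: eq_cintegral => x; rewrite inE/= in_itv/= andbT /zext => ->.
by move=> x /=; rewrite in_itv/= andbT /zext => /negP/negbTE ->.
Qed.

Lemma cintegrableS (D E : set R) g : measurable D -> measurable E -> D `<=` E ->
  cintegrable E g -> cintegrable D g.
Proof. by move=> mD mE DE [i1 i2]; split; [exact: integrableS i1|exact: integrableS i2]. Qed.

(** With h = w u this is Gamma(a) w(x) times the weighted fractional integral of u of order a. *)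
Definition conv_power a h x := cintegral `[0, x] (fun t => cpow (x - t)%:C (a - 1) * h t).

Lemma cmfun_cintegrable D g : cintegrable D g -> cmfun D g.
Proof.
move=> [/(measurable_int mu)/measurable_EFinP m1].
by move=> /(measurable_int mu)/measurable_EFinP m2.
Qed.

Lemma cmfunM D g h : cmfun D g -> cmfun D h -> cmfun D (fun x => g x * h x).
Proof.
move=> [g1 g2] [h1 h2]; split.
  rewrite (_ : (fun x => _) = (fun x => Re (g x) * Re (h x) - Im (g x) * Im (h x))).
    by apply: measurable_funB; exact: measurable_funM.
  by apply/funext => x; rewrite ReM.
rewrite (_ : (fun x => _) = (fun x => Re (g x) * Im (h x) + Im (g x) * Re (h x))).
  by apply: measurable_funD; exact: measurable_funM.
by apply/funext => x; rewrite ImM.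
Qed.

Lemma cintegrable_mul_bounded (k0 : R -> R[i]) g M : cintegrable setT k0 -> cmfun setT g ->
  (forall x, cmod (g x) <= M) -> cintegrable setT (fun x => k0 x * g x).
Proof.
move=> ki mg gM; have [k1 k2] := ki.
have M0 : 0 <= M by apply: le_trans (gM 0); exact: cmod_ge0.
have iG := integrable_EFinZ M measurableT
  (integrable_EFinD measurableT (integrable_norm k1) (integrable_norm k2)).
apply: le_cintegrable iG _ => //.
  by apply: cmfunM => //; exact: cmfun_cintegrable.
move=> x _; rewrite cmodM mulrC; apply: ler_pM => //; rewrite ?cmod_ge0//.
exact: cmod_le.
Qed.

Lemma cintegrable_laplace h s M c : (forall x, 0 < x -> ccont h x) ->
  (forall x, 0 < x -> cmod (h x) <= M * expR (c * x)) -> c < Re s ->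
  cintegrable pos (fun x => cexp (- s * x%:C) * h x).
Proof.
move=> ch hM cs; have sc : 0 < Re s - c by rewrite subr_gt0.
(* For p = 1 the Gamma kernel is a pure exponential, here with rate Re s - c. *)
have iG := integrable_EFinZ M (measurable_itv _) (integrable_gamma_kernel ltr01 sc).
apply: le_cintegrable iG _ => //.
  apply: ccont_cmfun => x x0; apply: ccvgM; last exact: ch.
  apply: ccvg_cexp; apply: ccvgM; first exact: ccvg_cst.
  by apply: ccvgC; exact: cvg_id.
move=> x; rewrite /= in_itv/= andbT => x0.
have -> : M * expR ((1 - 1) * ln x - (Re s - c) * x) = expR (- Re s * x) * (M * expR (c * x)).
  by rewrite mulrCA -expRD; congr (_ * expR _); ring.
rewrite cmodM cmod_cexp; apply: ler_pM => //; rewrite ?expR_ge0 ?cmod_ge0//; last exact: hM.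
by rewrite ler_expR ReM ReC ImC mulr0 subr0 ReN.
Qed.

Lemma cintegral_oo_cc g x : 0 < x -> cintegrable `]0, x[ g ->
  cintegral `[0, x] g = cintegral `]0, x[ g.
Proof.
move=> x0 [j1 j2]; have x0' : (BRight (0 : R) <= BLeft x)%O by rewrite bnd_simp.
apply: complexP => /=.
  rewrite [RHS](Rintegral_itv_obnd_cbnd j1).
  by rewrite [RHS](Rintegral_itv_bndo_bndc (integrable_itv_cbnd x0' j1)).
rewrite [RHS](Rintegral_itv_obnd_cbnd j2).
by rewrite [RHS](Rintegral_itv_bndo_bndc (integrable_itv_cbnd x0' j2)).
Qed.

(** Splitting exp(-s x) = exp(-s (x - t)) exp(-s t) makes the damped convolution a convolution of
    two integrable functions, the Gamma kernel [K] and the damped [H], so its integral is a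
    product. *)
Lemma laplace_conv_power a h s M c : 0 < Re a -> 0 < Re s -> (forall x, 0 < x -> ccont h x) ->
  (forall x, 0 < x -> cmod (h x) <= M * expR (c * x)) -> c < Re s ->
  cintegrable pos (fun x => cexp (- s * x%:C) * conv_power a h x) /\
  cintegral pos (fun x => cexp (- s * x%:C) * conv_power a h x) =
  cGamma a * cpow s (- a) * cintegral pos (fun x => cexp (- s * x%:C) * h x).
Proof.
move=> a0 s0 ch hM cs.
have M0 : 0 <= M.
  have := le_trans (cmod_ge0 _) (hM 1 ltr01); rewrite pmulr_lge0//; exact: expR_gt0.
pose K := zext (gamma_kernel a s); pose H := zext (fun x => cexp (- s * x%:C) * h x).
have iK : cintegrable setT K by apply: cintegrable_zext; exact: cintegrable_gamma_kernel.
have iH : cintegrable setT H.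
  by apply: cintegrable_zext; exact: cintegrable_laplace ch hM cs.
(* Boundedness of [H] makes K(x - t) H(t) integrable in t for every x, not just almost every x, so
   [C] can be identified pointwise. *)
have HM t : cmod (H t) <= M.
  rewrite /H /zext; case: ifPn => t0; last by rewrite cmod0.
  rewrite cmodM cmod_cexp ReM ReC ImC mulr0 subr0 ReN.
  apply: (@le_trans _ _ (expR (- Re s * t) * (M * expR (c * t)))).
    by rewrite ler_wpM2l ?expR_ge0 ?hM.
  rewrite mulrCA -expRD ler_piMr// expR_le1 -mulrDl nmulr_rle0 ?ltW//.
  by rewrite addrC subr_lt0.
have iP x : cintegrable setT (fun t => K (x - t) * H t).
  apply: cintegrable_mul_bounded HM; last exact: cmfun_cintegrable.
  by have [k1 k2] := iK; split;
    [exact: (integrable_preserving (@measurable_rsub R x) (@lebesgue_measure_reflect R x) k1)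
    |exact: (integrable_preserving (@measurable_rsub R x) (@lebesgue_measure_reflect R x) k2)].
pose C x := cintegral setT (fun t => K (x - t) * H t).
have P0 x t : ~ (`]0, x[%classic t) -> K (x - t) * H t = 0.
  rewrite /K /H /zext /= in_itv/= subr_gt0 => /negP; rewrite negb_and.
  by case/orP => /negbTE ->; rewrite ?mul0r ?mulr0.
have CE x : 0 < x -> cexp (- s * x%:C) * conv_power a h x = C x.
  move=> x0.
  have gE t : t \in `]0, x[%classic ->
      cexp (s * x%:C) * (K (x - t) * H t) = cpow (x - t)%:C (a - 1) * h t.
    rewrite inE/= in_itv/= => /andP[t0 tx].
    rewrite /K /H /zext subr_gt0 tx t0 /gamma_kernel /cpow clogC ?subr_gt0// !mulrA.
    congr (_ * _); rewrite -!cexpD; congr cexp; rewrite rmorphB; ring.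
  have io : cintegrable `]0, x[%classic (fun t => K (x - t) * H t).
    by apply: cintegrableS (iP x).
  (* Dropping the end points removes t = x, where [cpow] is taken at 0, and t = 0, where nothing is
     known about [h]. *)
  rewrite /conv_power cintegral_oo_cc//; last first.
    by apply: eq_cintegrable (cintegrableZ (cexp (s * x%:C)) _ io).
  rewrite -(eq_cintegral gE) cintegralZ// mulrA -cexpD mulNr addNr cexp0 mul1r.
  exact: (cintegral_supp (P0 x)).
have C0 x : ~ pos x -> C x = 0.
  rewrite /= in_itv/= andbT => /negP; rewrite -leNgt => x0.
  rewrite /C (eq_cintegral (h := fun=> 0)).
    by apply: complexP; rewrite /= /Rintegral integral0.
  move=> t _; apply: P0; rewrite /= in_itv/= => /andP[t0 tx].
  by have := lt_le_trans (lt_trans t0 tx) x0; rewrite ltxx.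
have iC : cintegrable pos C.
  by apply/(cintegrable_supp _ C0) => //; exact: cintegrable_convolution.
have CE' : {in pos, C =1 (fun x => cexp (- s * x%:C) * conv_power a h x)}.
  by move=> x; rewrite inE/= in_itv/= andbT => /CE.
split; first exact: eq_cintegrable CE' iC.
rewrite -(eq_cintegral CE') (cintegral_supp C0) cintegral_convolution//.
by rewrite !cintegral_zext -/(laplace_power a s) laplace_powerE.
Qed.

End ConvolutionLaplace.

(** * Functions of exponential growth and transforms of their derivatives *)

Section ExpClass.
Variable R : realType.
Local Notation Re := (@complex.Re R).
Local Notation Im := (@complex.Im R).
Notation mu := (@lebesgue_measure R).
Local Notation pos := (`](0 : R)%R, +oo[%classic).
Implicit Types (a s z l : R[i]) (x y t p k c M T : R) (g h G : R -> R[i]) (f df : R -> R).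

(** The limit bounds [f] near 0, compactness bounds it on [u, T], and the hypothesis takes over
    beyond T. The rate |c| keeps the exponential at least 1, so one constant covers the three
    zones. *)
Lemma global_exp_bound f M c T (l : R) : (forall x, 0 < x -> {for x, continuous f}) ->
  f x @[x --> 0^'+] --> l -> 0 < T -> (forall x, T <= x -> `|f x| <= M * expR (c * x)) ->
  exists M', forall x, 0 < x -> `|f x| <= M' * expR (`|c| * x).
Proof.
move=> cf /cvgrPdist_lt/(_ _ ltr01)[d /= d0 Hd] T0 fT.
pose u := Num.min (d / 2) T.
have u0 : 0 < u by rewrite lt_min T0 divr_gt0.
have uT : u <= T by rewrite ge_min lexx orbT.
have cn : {within `[u, T], continuous (fun x => `|f x|)}.
  apply: continuous_in_subspaceT => x; rewrite inE/= in_itv/= => /andP[ux _].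
  by apply: cvg_norm; apply: cf; exact: lt_le_trans ux.
have [b _ fb] := EVT_max uT cn.
exists (`|l| + 1 + `|f b| + `|M|) => x x0.
have e1 : 1 <= expR (`|c| * x) by rewrite -expR0 ler_expR mulr_ge0// ltW.
have big y : y <= `|l| + 1 + `|f b| -> y <= (`|l| + 1 + `|f b| + `|M|) * expR (`|c| * x).
  move=> yB; have := normr_ge0 l; have := normr_ge0 (f b); have := normr_ge0 M.
  move=> h1 h2 h3; rewrite -[y]mulr1; apply: (@le_trans _ _ ((`|l| + 1 + `|f b| + `|M|) * 1)).
    by rewrite !mulr1; lra.
  by rewrite ler_wpM2l//; lra.
have [xu|ux] := ltP x u.
  apply: big; have : ball_ [eta Num.norm] 0 d x.
    rewrite /ball_/= sub0r normrN gtr0_norm// (lt_le_trans xu)//.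
    by rewrite (@le_trans _ _ (d / 2))// ?ge_min ?lexx//; lra.
  move=> /Hd/(_ x0) h; have := normr_ge0 (f b); have := ler_normB l (l - f x).
  rewrite opprB addrCA subrr addr0; lra.
have [xT|Tx] := leP x T.
  apply: big; have := fb x; rewrite in_itv/= ux xT => /(_ isT).
  have := normr_ge0 l; lra.
apply: (le_trans (fT _ (ltW Tx))).
apply: (@le_trans _ _ (`|M| * expR (`|c| * x))).
  apply: (@le_trans _ _ (`|M| * expR (c * x))).
    by rewrite ler_wpM2r ?expR_ge0// ler_norm.
  by rewrite ler_wpM2l// ler_expR ler_wpM2r ?ler_norm// ltW.
by rewrite ler_wpM2r ?expR_ge0// lerDr addr_ge0// addr_ge0.
Qed.

Lemma MVT_bound f df x y (B : R) : (forall x, 0 < x -> is_derive x 1 f (df x)) ->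
  0 < x -> x <= y -> (forall z : R, x <= z <= y -> `|df z| <= B) ->
  `|f y - f x| <= B * (y - x).
Proof.
move=> fd x0 xy dB.
have cf : {within `[x, y], continuous f}.
  apply: continuous_in_subspaceT => z; rewrite inE/= in_itv/= => /andP[xz _].
  by apply: is_derive_cont (fd z _); exact: lt_le_trans xz.
have fd' (z : R) : z \in `]x, y[ -> is_derive z 1 f (df z).
  by rewrite in_itv/= => /andP[xz _]; apply: fd; exact: lt_trans xz.
have [z] := MVT_segment xy fd' cf; rewrite in_itv/= => zxy ->.
by rewrite normrM (ger0_norm (_ : 0 <= y - x)) ?subr_ge0// ler_wpM2r ?subr_ge0// dB.
Qed.

(** A bounded derivative near 0 makes [f] Cauchy at 0+. Beyond 1 the mean value theorem gives growth
    M exp(c x) (x - 1), and x - 1 <= exp x costs one unit in the rate. *)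
Lemma primitive_exp_bound f df M c : 0 <= c ->
  (forall x, 0 < x -> is_derive x 1 f (df x)) ->
  (forall x, 0 < x -> `|df x| <= M * expR (c * x)) ->
  (exists l : R, f x @[x --> 0^'+] --> l) /\
  exists M', forall x, 0 < x -> `|f x| <= M' * expR (`|c + 1| * x).
Proof.
move=> c0 fd dM.
have M0 : 0 <= M.
  have := le_trans (normr_ge0 _) (dM 1 ltr01); rewrite pmulr_lge0//; exact: expR_gt0.
pose B := M * expR c; have B0 : 0 <= B by rewrite mulr_ge0// expR_ge0.
have [l fl] : exists l : R, f x @[x --> 0^'+] --> l.
  apply/cvg_ex/cauchy_cvgP; apply: cauchy_exP => e e0.
  (* Below [x0] the oscillation is at most B x0 <= e/2; B + 1 keeps the denominator positive even if
     B = 0. *)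
  pose x0 := Num.min 1 (e / (2 * (B + 1))).
  have B1 : 0 < 2 * (B + 1) by lra.
  have x00 : 0 < x0 by rewrite lt_min ltr01 divr_gt0.
  have x01 : x0 <= 1 by rewrite ge_min lexx.
  have Bx0 : (B + 1) * x0 <= e / 2.
    have : x0 <= e / (2 * (B + 1)) by rewrite ge_min lexx orbT.
    by rewrite ler_pdivlMr//; lra.
  exists (f x0); suff : \forall y \near 0^'+, ball (f x0) e (f y) by [].
  near=> y.
  have y0 : 0 < y by [].
  have yx : y <= x0 by near: y; exact: nbhs_right_le.
  apply: (@le_lt_trans _ _ (B * (x0 - y))).
    apply: (MVT_bound fd) => // z /andP[yz zx].
    have z0 : 0 < z by exact: lt_le_trans yz.
    apply: (le_trans (dM _ z0)); rewrite ler_wpM2l// ler_expR ler_piMr//.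
    exact: le_trans x01.
  have : B * (x0 - y) <= B * x0 by rewrite ler_wpM2l// gerBl ltW.
  lra.
split; first by exists l.
have cf x : 0 < x -> {for x, continuous f} by move=> x0; exact: is_derive_cont (fd _ x0).
apply: (@global_exp_bound f (`|f 1| + M) (c + 1) 1 l cf fl ltr01) => x x1.
have x0 : 0 < x by exact: lt_le_trans x1.
have : `|f x - f 1| <= M * expR (c * x) * (x - 1).
  apply: (MVT_bound fd) => // z /andP[z1 zx].
  have z0 : 0 < z by exact: lt_le_trans z1.
  apply: (le_trans (dM _ z0)); by rewrite ler_wpM2l// ler_expR ler_wpM2l.
have ex : x - 1 <= expR x by have := expR_ge1Dx x; lra.
have : M * expR (c * x) * (x - 1) <= M * expR ((c + 1) * x).
  by rewrite mulrDl mul1r expRD mulrA ler_wpM2l// mulr_ge0// expR_ge0.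
have e1 : 1 <= expR ((c + 1) * x).
  by rewrite -expR0 ler_expR mulr_ge0 ?ltW// ltr_wpDl.
have : `|f 1| <= `|f 1| * expR ((c + 1) * x) by rewrite ler_peMr.
have := ler_normD (f x - f 1) (f 1); rewrite subrK mulrDl; lra.
Unshelve. all: by end_near. Qed.

(** A class closed under primitives. The exponential bound holds on the whole half line, so it
    yields convergence of the transform directly. *)
Definition exp_class g := [/\ forall x, 0 < x -> ccont g x, exists l, ccvg 0^'+ g l &
  exists M c, 0 <= c /\ forall x, 0 < x -> cmod (g x) <= M * expR (c * x)].

Lemma exp_class_intro g l M c T : (forall x, 0 < x -> ccont g x) -> ccvg 0^'+ g l ->
  0 < T -> (forall x, T <= x -> cmod (g x) <= M * expR (c * x)) -> exp_class g.
Proof.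
move=> cg gl T0 gT; split => //; first by exists l.
have [M1 H1] : exists M', forall x, 0 < x -> `|Re (g x)| <= M' * expR (`|c| * x).
  apply: (@global_exp_bound (fun x => Re (g x)) M c T (Re l)) => //.
  - by move=> x /cg[].
  - by case: gl.
  - by move=> x /gT; apply: le_trans; exact: normRe_cmod.
have [M2 H2] : exists M', forall x, 0 < x -> `|Im (g x)| <= M' * expR (`|c| * x).
  apply: (@global_exp_bound (fun x => Im (g x)) M c T (Im l)) => //.
  - by move=> x /cg[].
  - by case: gl.
  - by move=> x /gT; apply: le_trans; exact: normIm_cmod.
exists (M1 + M2), `|c|; split => // x x0.
by apply: (le_trans (cmod_le _)); rewrite mulrDl lerD// ?H1 ?H2.
Qed.

Lemma exp_class_primitive G g :
  (forall x, 0 < x -> is_cder G x (g x)) -> exp_class g -> exp_class G.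
Proof.
move=> dG [cg _ [M [c [c0 gM]]]].
have [[l1 L1] [M1 H1]] : (exists l : R, Re (G x) @[x --> 0^'+] --> l) /\
    exists M', forall x, 0 < x -> `|Re (G x)| <= M' * expR (`|c + 1| * x).
  apply: (@primitive_exp_bound (fun x => Re (G x)) (fun x => Re (g x)) M c) => //.
  - by move=> x /dG[].
  - by move=> x /gM; apply: le_trans; exact: normRe_cmod.
have [[l2 L2] [M2 H2]] : (exists l : R, Im (G x) @[x --> 0^'+] --> l) /\
    exists M', forall x, 0 < x -> `|Im (G x)| <= M' * expR (`|c + 1| * x).
  apply: (@primitive_exp_bound (fun x => Im (G x)) (fun x => Im (g x)) M c) => //.
  - by move=> x /dG[].
  - by move=> x /gM; apply: le_trans; exact: normIm_cmod.
split.
- by move=> x /dG; exact: is_cder_cont.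
- by exists (l1 +i* l2).
- exists (M1 + M2), `|c + 1|; split => // x x0.
  by apply: (le_trans (cmod_le _)); rewrite mulrDl lerD// ?H1 ?H2.
Qed.

Lemma for_large_Re_and (P Q : R[i] -> Prop) :
  for_large_Re P -> for_large_Re Q -> for_large_Re (fun s => P s /\ Q s).
Proof.
move=> [u Pu] [v Qv]; exists (Num.max u v) => s; rewrite gt_max => /andP[us vs].
by split; [exact: Pu|exact: Qv].
Qed.

Lemma for_large_ReS (P Q : R[i] -> Prop) :
  (forall s, P s -> Q s) -> for_large_Re P -> for_large_Re Q.
Proof. by move=> PQ [u Pu]; exists u => s /Pu/PQ. Qed.

Lemma for_large_Re_gt0 : for_large_Re (fun s : R[i] => 0 < Re s).
Proof. by exists 0. Qed.

Definition laplace g s := cintegral pos (fun x => cexp (- s * x%:C) * g x).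

Lemma exp_class_integrable g : exp_class g ->
  for_large_Re (fun s => cintegrable pos (fun x => cexp (- s * x%:C) * g x)).
Proof.
move=> [cg _ [M [c [_ gM]]]]; exists c => s cs; exact: cintegrable_laplace cg gM cs.
Qed.

(** Fundamental theorem for exp(-s x) G(x), which tends to [l] at 0+ and to 0 at infinity once Re s
    exceeds the growth rate of [G]. *)
Lemma laplace_derivative G g l : exp_class G -> exp_class g ->
  (forall x, 0 < x -> is_cder G x (g x)) -> ccvg 0^'+ G l ->
  for_large_Re (fun s => laplace g s = s * laplace G s - l).
Proof.
move=> eG eg dG Gl; have [cG _ [M [c [c0 GM]]]] := eG; have [cg _ _] := eg.
have big : for_large_Re (fun s : R[i] => c < Re s) by exists c.
apply: for_large_ReS (for_large_Re_and big
  (for_large_Re_and (exp_class_integrable eG) (exp_class_integrable eg))) => s [cs [iG ig]].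
pose E x := cexp (- s * x%:C) * G x.
pose e x := cexp (- s * x%:C) * g x + (- s) * (cexp (- s * x%:C) * G x).
have dexp x : is_cder (fun x => cexp (- s * x%:C)) x (cexp (- s * x%:C) * (- s)).
  apply: is_cder_cexp; apply: is_cder_eq.
    by apply: is_cderM; [exact: is_cder_cst|exact: is_cderC (is_derive_id _ _)].
  by rewrite mul0r add0r mulr1.
have dE x : 0 < x -> is_cder E x (e x).
  move=> x0; apply: is_cder_eq; first exact: is_cderM (dexp x) (dG x x0).
  by rewrite /e; ring.
have ce x : 0 < x -> ccont e x.
  move=> x0; have h := is_cder_cont (dexp x); apply: ccvgD.
    by apply: ccvgM; [exact: h|exact: cg].
  apply: ccvgM; first exact: ccvg_cst.
  by apply: ccvgM; [exact: h|exact: cG].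
have ie : cintegrable pos e by apply: cintegrableD => //; exact: cintegrableZ.
have E0 : ccvg 0^'+ E l.
  rewrite -[l]mul1r; apply: ccvgM => //; rewrite -cexp0 -(mulr0 (- s)).
  apply: ccvg_cexp; apply: ccvgM; first exact: ccvg_cst.
  rewrite -(rmorph0 (real_complex R)); apply: ccvgC.
  by apply: cvg_at_right_filter; exact: cvg_id.
have Ey : ccvg +oo E 0.
  have k0 : 0 < Re s - c by rewrite subr_gt0.
  have H : M * expR (0 * ln t - (Re s - c) * t) @[t --> +oo] --> (0 : R).
    rewrite -[X in _ --> X](mulr0 M); apply: cvgM; first exact: cvg_cst.
    exact: cvg_expR_ln_y.
  apply: ccvg_cmod0 H; near=> x.
  have x0 : 0 < x by near: x; exact: nbhs_pinfty_gt.
  have -> : M * expR (0 * ln x - (Re s - c) * x) = expR (- Re s * x) * (M * expR (c * x)).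
    by rewrite mulrCA -expRD; congr (_ * expR _); ring.
  rewrite cmodM cmod_cexp; apply: ler_pM; rewrite ?expR_ge0 ?cmod_ge0//; last exact: GM.
  by rewrite ler_expR ReM ReC ImC mulr0 subr0 ReN.
have := cFTC_0y dE ce ie E0 Ey.
rewrite /e cintegralD//; last exact: cintegrableZ.
rewrite cintegralZ// -/(laplace g s) -/(laplace G s) => H.
have -> : laplace g s = laplace g s + - s * laplace G s + s * laplace G s by ring.
by rewrite H sub0r addrC.
Unshelve. all: by end_near. Qed.

Lemma exp_class_chain (G : nat -> R -> R[i]) (n : nat) :
  (forall k : nat, (k < n)%N -> forall x, 0 < x -> is_cder (G k) x (G k.+1 x)) ->
  exp_class (G n) -> forall k : nat, (k <= n)%N -> exp_class (G k).
Proof.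
move=> dG en k kn; have : (n - k <= n)%N by exact: leq_subr.
(* The induction descends from n: [j] counts how many primitives have been taken. *)
rewrite -{2}(subKn kn); elim: (n - k)%N => [|j ih] jn; first by rewrite subn0.
apply: (@exp_class_primitive _ (G (n - j)%N)); last by apply: ih; exact: ltnW.
move=> x x0; have -> : (n - j = (n - j.+1).+1)%N by rewrite subnSK.
by apply: dG => //; rewrite ltn_subrL (leq_ltn_trans _ jn).
Qed.

Lemma laplace_chain (G : nat -> R -> R[i]) (l : nat -> R[i]) (n : nat) :
  (forall k : nat, (k < n)%N -> forall x, 0 < x -> is_cder (G k) x (G k.+1 x)) ->
  exp_class (G n) -> (forall k : nat, (k < n)%N -> ccvg 0^'+ (G k) (l k)) ->
  for_large_Re (fun s => laplace (G n) s =
    s ^+ n * laplace (G 0%N) s - \sum_(0 <= i < n) s ^+ (n - i - 1) * l i).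
Proof.
move=> dG en Gl; have eG := exp_class_chain dG en.
have H m : (m <= n)%N -> for_large_Re (fun s => laplace (G m) s =
    s ^+ m * laplace (G 0%N) s - \sum_(0 <= i < m) s ^+ (m - i - 1) * l i).
  elim: m => [|m ih] mn.
    by exists 0 => s _; rewrite big_geq// subr0 expr0 mul1r.
  have D := laplace_derivative (eG _ (ltnW mn)) (eG _ mn) (dG _ mn) (Gl _ mn).
  apply: for_large_ReS (for_large_Re_and D (ih (ltnW mn))) => s [-> ->].
  rewrite big_nat_recr//= subSnn subnn expr0 mul1r mulrBr mulrA -exprS opprD addrA.
  congr (_ - _ - _); rewrite mulr_sumr; apply: eq_big_nat => i /andP[_ im].
  by rewrite mulrA -exprS; congr (_ ^+ _ * _); rewrite !subn1 prednK ?subn_gt0// subSn// ltnW.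
exact: H.
Qed.

End ExpClass.

(** * Transfer to the weighted operators *)

Section WeightedLaplace.
Variable R : realType.
Local Notation Re := (@complex.Re R).
Local Notation Im := (@complex.Im R).
Notation mu := (@lebesgue_measure R).
Local Notation pos := (`](0 : R)%R, +oo[%classic).
Implicit Types (a s l : R[i]) (x y t c M T : R) (w f g u h : R -> R[i]) (n m i k : nat).

Lemma ccvgV (F : set_system R) {FF : Filter F} g l : l != 0 ->
  ccvg F g l -> ccvg F (fun x => (g x)^-1) l^-1.
Proof. by move=> l0 /ccvgP gl; apply/ccvgP; exact: (@cvgV R[i]) gl. Qed.

Lemma ccvg_cvg0 g l : ccvg 0^'+ g l -> cvg0 g.
Proof. by move=> /ccvgP gl; apply/cvg_ex; exists l. Qed.

Lemma ccvg_lim0 g l : ccvg 0^'+ g l -> lim0 g = l.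
Proof. by move=> /ccvgP gl; apply: cvg_lim gl; exact: norm_hausdorff. Qed.

Lemma cvg0_ccvg g : cvg0 g -> ccvg 0^'+ g (lim0 g).
Proof. by move=> gc; apply/ccvgP. Qed.

Lemma continuous_ge0P g : continuous_ge0 g ->
  (forall x, 0 < x -> ccont g x) /\ ccvg 0^'+ g (g 0).
Proof.
move=> /continuous_within_itvcyP[cg g0]; split; last exact/ccvgP.
by move=> x x0; apply/ccvgP; apply: cg; rewrite in_itv/= andbT.
Qed.

(** The identity is asked for only at x > 0, because the weighted derivatives are meaningful only
    there. *)
Lemma wlaplaceE w u h s : (forall x, 0 < x -> w x * u x = h x) ->
  cintegrable pos (fun x => cexp (- s * x%:C) * h x) ->
  wlaplace_cvg w u s /\ wlaplace w u s = laplace h s.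
Proof.
move=> wu ih.
have E : {in pos, (fun x => cexp (- s * x%:C) * h x) =1
    (fun x => cexp (- s * x%:C) * w x * u x)}.
  by move=> x; rewrite inE/= in_itv/= andbT => x0; rewrite -wu// mulrA.
have iu := eq_cintegrable (measurable_itv _) E ih.
split; first exact/cintegrable_0y_cy.
by rewrite /wlaplace cintegral_0y_cy//; apply/esym/eq_cintegral.
Qed.

Lemma exp_class_weighted w u : (forall x, 0 < x -> ccont w x) -> ccvg 0^'+ w (w 0) ->
  (forall x, 0 < x -> ccont u x) -> cvg0 u -> wexp_order w u ->
  exp_class (fun x => w x * u x).
Proof.
move=> cw w0 cu u0 [c [M [T [M0 T0 uM]]]].
apply: (@exp_class_intro _ _ (w 0 * lim0 u) M c T) => //.
- by move=> x x0; apply: ccvgM; [exact: cw|exact: cu].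
- by apply: ccvgM => //; exact: cvg0_ccvg.
- by move=> x /uM; rewrite cmodE lecR.
Qed.

Section Weight.
Variables (w : R -> R[i]).
Hypothesis w_neq0 : forall x, 0 <= x -> w x != 0.
Hypothesis cw : forall x, 0 < x -> ccont w x.
Hypothesis w0 : ccvg 0^'+ w (w 0).

Lemma RLint_pos_laplace a u : 0 < Re a -> exp_class (fun x => w x * u x) ->
  for_large_Re (fun s => wlaplace_cvg w (RLint_pos w a u) s /\
    wlaplace w (RLint_pos w a u) s = cpow s (- a) * laplace (fun x => w x * u x) s).
Proof.
move=> a0 [ch _ [M [c [c0 hM]]]]; exists c => s cs.
(* The rate in [exp_class] is nonnegative, so Re s > c also places s in the right half plane, where
   the transform of the kernel is known. *)
have s0 : 0 < Re s by exact: le_lt_trans cs.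
pose h x := w x * u x.
have [i1 e1] := laplace_conv_power a0 s0 ch hM cs.
have i2 := cintegrableZ (cGamma a)^-1 (measurable_itv _) i1.
pose H x := (cGamma a)^-1 * conv_power a h x.
have wH x : 0 < x -> w x * RLint_pos w a u x = H x.
  move=> x0; have wx := w_neq0 (ltW x0).
  rewrite /RLint_pos invfM mulrA mulrCA divff// mulr1; congr (_ * _).
  by apply: eq_cintegral => t _; rewrite mulrA.
have E : {in pos, (fun x => (cGamma a)^-1 * (cexp (- s * x%:C) * conv_power a h x)) =1
    (fun x => cexp (- s * x%:C) * H x)} by move=> x _; rewrite mulrCA.
have [W ->] := wlaplaceE wH (eq_cintegrable (measurable_itv _) E i2).
split => //; rewrite /laplace -(eq_cintegral E) cintegralZ// e1.
by rewrite !mulrA mulVf ?mul1r// cGamma_neq0.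
Qed.

Lemma is_cder_weighted n g k x : wD_defined w n g -> (k < n)%N -> 0 < x ->
  is_cder (fun x => w x * iter k (wD w) g x) x (w x * iter k.+1 (wD w) g x).
Proof.
move=> wd kn x0; have [dw dg] := wd k kn x x0; have wx := w_neq0 (ltW x0).
apply: is_cder_eq; first exact: is_cderM (cderivableP dw) (cderivableP dg).
by rewrite iterS /wD mulrDr mulrA [w x * (_ / _)]mulrC divfK// addrC.
Qed.

(** The functions [G k] = w D^k g form a chain of successive classical derivatives. Hypotheses on
    the top one alone descend to all of them, and the limits of D^k g follow on dividing by w, since
    w(0) is nonzero. *)
Lemma weighted_iter n g : wD_defined w n g ->
  extends_continuous_ge0 (iter n (wD w) g) -> wexp_order w (iter n (wD w) g) ->
  [/\ forall k, (k <= n)%N -> exp_class (fun x => w x * iter k (wD w) g x),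
      forall k, (k <= n)%N -> cvg0 (iter k (wD w) g) &
      for_large_Re (fun s => laplace (fun x => w x * iter n (wD w) g x) s =
        s ^+ n * laplace (fun x => w x * g x) s -
        lim0 w * \sum_(0 <= i < n) s ^+ (n - i - 1) * lim0 (iter i (wD w) g))].
Proof.
move=> wd [cD D0] De.
have cD' x : 0 < x -> ccont (iter n (wD w) g) x by move=> x0; apply/ccvgP; exact: cD.
pose G k x := w x * iter k (wD w) g x.
have dG k : (k < n)%N -> forall x, 0 < x -> is_cder (G k) x (G k.+1 x).
  by move=> kn x x0; exact: is_cder_weighted kn x0.
have eGn : exp_class (G n) by exact: exp_class_weighted.
have eG := exp_class_chain dG eGn.
have c0 k : (k <= n)%N -> cvg0 (iter k (wD w) g).
  move=> /eG[_ [l Gl] _]; apply: (@ccvg_cvg0 _ ((w 0)^-1 * l)).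
  have H : ccvg 0^'+ (fun x => (w x)^-1 * G k x) ((w 0)^-1 * l).
    by apply: ccvgM => //; apply: ccvgV => //; exact: w_neq0.
  apply: near_eq_ccvg H; near=> x; have x0 : 0 < x by [].
  by rewrite /G mulrA mulVf ?mul1r// w_neq0// ltW.
split => //.
have Gl k : (k < n)%N -> ccvg 0^'+ (G k) (w 0 * lim0 (iter k (wD w) g)).
  by move=> kn; apply: ccvgM => //; apply: cvg0_ccvg; apply: c0; exact: ltnW.
apply: for_large_ReS (laplace_chain dG eGn Gl) => s ->; congr (_ - _).
rewrite (ccvg_lim0 w0) mulr_sumr; apply: eq_bigr => i _; exact: mulrCA.
Unshelve. all: by end_near. Qed.

(** The integral of a bounded function over [0, x] is O(x). This removes the surplus boundary term
    of an integer order. *)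
Lemma RLint_pos1_0 u : exp_class (fun x => w x * u x) -> ccvg 0^'+ (RLint_pos w 1 u) 0.
Proof.
move=> [ch _ [M [c [c0 hM]]]]; pose h x := w x * u x.
have G1 : cGamma 1 != 0 :> R[i] by rewrite cGamma_neq0.
have M0 : 0 <= M.
  have := le_trans (cmod_ge0 _) (hM 1 ltr01); rewrite pmulr_lge0//; exact: expR_gt0.
rewrite -(mulr0 (cGamma 1 * w 0)^-1); apply: ccvgM.
  apply: ccvgV; first by rewrite mulf_neq0// w_neq0.
  by apply: ccvgM => //; exact: ccvg_cst.
pose B := M * expR c.
have H : 2 * B * x @[x --> (0 : R)^'+] --> (0 : R).
  rewrite -[X in _ --> X](mulr0 (2 * B)); apply: cvgM; first exact: cvg_cst.
  by apply: cvg_at_right_filter; exact: cvg_id.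
apply: ccvg_cmod0 H; near=> x; have x0 : 0 < x by [].
have x1 : x <= 1 by near: x; exact: nbhs_right_le.
have hE : (fun t => cpow (x - t)%:C (1 - 1) * w t * u t) = h.
  by apply/funext => t; rewrite subrr /cpow mul0r cexp0 mul1r.
have sx : `]0, x[%classic `<=` pos.
  by move=> t /=; rewrite !in_itv/= andbT => /andP[].
have hB t : `]0, x[%classic t -> cmod (h t) <= B.
  rewrite /= in_itv/= => /andP[t0 tx]; apply: (le_trans (hM _ t0)).
  rewrite ler_wpM2l// ler_expR ler_piMr//; exact: le_trans (ltW tx) x1.
have iB : mu.-integrable `]0, x[%classic (EFin \o (fun=> B)).
  apply: (@integrableS _ _ _ mu `[0, x]%classic) => //.
    exact: subset_itv_oo_cc.
  apply: continuous_compact_integrable; first exact: segment_compact.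
  by apply: continuous_subspaceT => t; exact: cvg_cst.
have ih : cintegrable `]0, x[%classic h.
  apply: le_cintegrable iB hB => //; have [m1 m2] := ccont_cmfun ch.
  by split; [exact: measurable_funS sx m1|exact: measurable_funS sx m2].
rewrite hE cintegral_oo_cc//; apply: (le_trans (cmod_cintegral_le _ ih iB hB)) => //.
rewrite Rintegral_cst//= lebesgue_measure_itv/= lte_fin x0 -EFinB /= subr0; lra.
Unshelve. all: by end_near. Qed.

End Weight.

End WeightedLaplace.

(** * Arithmetic of the orders of integration *)

Section Orders.
Variable R : realType.
Local Notation Re := (@complex.Re R).
Implicit Types (a s : R[i]) (w f : R -> R[i]) (n m i : nat).

Lemma truncn_Re a n : (0 < n)%N -> n%:R - 1 <= Re a < n%:R ->
  Num.truncn (Re a) = n.-1.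
Proof.
move=> n0 /andP[h1 h2]; apply/eqP; rewrite truncn_eq.
  by rewrite prednK// h2 andbT -subn1 natrB.
by apply: le_trans h1; rewrite subr_ge0 ler1n.
Qed.

Lemma frac_orderE a n : (0 < n)%N -> n%:R - 1 <= Re a < n%:R -> frac_order a = n.
Proof. by move=> n0 an; rewrite /frac_order (truncn_Re n0 an) prednK. Qed.

Lemma is_nat_order_nat n : is_nat_order (n%:R : R[i]).
Proof. by rewrite /is_nat_order Re_nat natrK. Qed.

Lemma RLder_nat w f n : RLder w n%:R f = iter n (wD w) f.
Proof. by rewrite /RLder is_nat_order_nat Re_nat natrK. Qed.

Lemma RLder_defined_nat w f n : RLder_defined w n%:R f = wD_defined w n f.
Proof. by rewrite /RLder_defined is_nat_order_nat Re_nat natrK. Qed.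

Lemma RLint_oppn w f n : RLint w (- n%:R) f = iter n (wD w) f.
Proof. by rewrite /RLint ReN Re_nat oppr_gt0 ltNge ler0n opprK RLder_nat. Qed.

(* The integral of order n - i - a with i >= 1 is the derivative of order
   a - (n - i), whose own fractional part is again integrated at order n - a. *)
Lemma RLint_fractional w f a n i : (0 < n)%N -> n%:R - 1 <= Re a < n%:R ->
  ~~ is_nat_order a -> (i < n)%N ->
  RLint w (n%:R - i%:R - a) f = iter i (wD w) (RLint_pos w (n%:R - a) f).
Proof.
move=> n0 an anat iltn; have /andP[h1 h2] := an.
case: i iltn => [|i] iltn.
  by rewrite subr0 /RLint !ReImE subr_gt0 h2.
have Rb : Re (- (n%:R - i.+1%:R - a)) = Re a - n%:R + i.+1%:R by rewrite !ReImE; ring.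
have i1 : i.+1%:R = i%:R + 1 :> R by rewrite -addn1 natrD.
have bi : i.+1%:R - 1 <= Re (- (n%:R - i.+1%:R - a)) < i.+1%:R.
  by rewrite Rb i1; apply/andP; split; lra.
rewrite /RLint ltNge.
have -> /= : Re (n%:R - i.+1%:R - a) <= 0.
  by move: bi => /andP[+ _]; rewrite ReN i1; have := ler0n R i; lra.
(* If a - n + i + 1 were a natural number, it would be i, hence a = n - 1, contrary to the
   assumption on [a]. *)
rewrite /RLder ifF; last first.
  apply/negP; rewrite /is_nat_order (truncn_Re _ bi)//= => /eqP e.
  move/negP: anat; apply; rewrite /is_nat_order (truncn_Re n0 an); apply/eqP.
  have -> : n.-1%:R = n%:R - 1 :> R[i] by rewrite -subn1 natrB.
  have i1' : i.+1%:R = i%:R + 1 :> R[i] by rewrite -addn1 natrD.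
  have -> : a = - (n%:R - i.+1%:R - a) + n%:R - i.+1%:R by ring.
  by rewrite e i1'; ring.
have bE : i.+1%:R - - (n%:R - i.+1%:R - a) = n%:R - a by ring.
by rewrite (frac_orderE (ltn0Sn i) bi) bE.
Qed.

End Orders.

(** * The three transform formulas *)

Theorem theorem3p2 (R : realType) (w f : R -> R[i]) (alpha : R[i])
    (alpha_gt0 : 0 < complex.Re alpha)
    (w_neq0 : forall x : R, 0 <= x -> w x != 0)
    (w_cont : continuous_ge0 w)
    (f_cont : continuous_ge0 f)
    (f_exp : wexp_order w f) :
  [/\ for_large_Re (fun s =>
        [/\ wlaplace_cvg w f s,
            wlaplace_cvg w (RLint w alpha f) s &
            wlaplace w (RLint w alpha f) s
            = cpow s (- alpha) * wlaplace w f s]),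
      forall n : nat, (0 < n)%N ->
        n%:R - 1 <= complex.Re alpha < n%:R ->
        RLder_defined w alpha f ->
        extends_continuous_ge0 (RLder w alpha f) ->
        wexp_order w (RLder w alpha f) ->
        [/\ cvg0 w,
            forall i : nat, (i < n)%N ->
              cvg0 (RLint w (n%:R - i%:R - alpha) f) &
            for_large_Re (fun s =>
              [/\ wlaplace_cvg w f s,
                  wlaplace_cvg w (RLder w alpha f) s &
                  wlaplace w (RLder w alpha f) s
                  = cpow s alpha * wlaplace w f s
                    - lim0 w * \sum_(0 <= i < n)
                        s ^+ (n - i - 1)
                        * lim0 (RLint w (n%:R - i%:R - alpha) f)])] &
      forall n : nat, (0 < n)%N ->
        n%:R - 1 <= complex.Re alpha < n%:R ->
        RLder_defined w n%:R f ->
        extends_continuous_ge0 (RLder w n%:R f) ->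
        wexp_order w (RLder w n%:R f) ->
        [/\ cvg0 w,
            forall i : nat, (i < n)%N -> cvg0 (iter i (wD w) f) &
            for_large_Re (fun s =>
              [/\ wlaplace_cvg w f s,
                  wlaplace_cvg w (Cder w alpha f) s &
                  wlaplace w (Cder w alpha f) s
                  = cpow s alpha * wlaplace w f s
                    - lim0 w * \sum_(0 <= i < n)
                        cpow s (alpha - i%:R - 1)
                        * lim0 (iter i (wD w) f)])]].
Proof.
have [cw w0] := continuous_ge0P w_cont; have [cf f0] := continuous_ge0P f_cont.
have wc0 := ccvg_cvg0 w0.
have ef : exp_class (fun x => w x * f x).
  by exact: (exp_class_weighted cw w0 cf (ccvg_cvg0 f0) f_exp).
have Lf := exp_class_integrable ef.
have Lu u : exp_class (fun x => w x * u x) ->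
    for_large_Re (fun s => wlaplace_cvg w u s /\
      wlaplace w u s = laplace (fun x => w x * u x) s).
  by move=> /exp_class_integrable; apply: for_large_ReS => s; exact: wlaplaceE.
have Lwf := Lu f ef; have L0 := for_large_Re_gt0 R.
have neq0 (s : R[i]) : 0 < complex.Re s -> s != 0.
  by apply: contraTneq => ->; rewrite ltxx.
split.
- have H := RLint_pos_laplace w_neq0 alpha_gt0 ef.
  rewrite /RLint alpha_gt0.
  by apply: for_large_ReS (for_large_Re_and Lwf H) => s [[? ->] [? ->]].
- move=> n n0 an Dd Dc De; have /andP[h1 h2] := an.
  have [aN|aN] := boolP (is_nat_order alpha).
    have [m nm] : exists m, n = m.+1 by exists n.-1; rewrite prednK.
    have aE : alpha = m%:R by rewrite (eqP aN) (truncn_Re n0 an) nm.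
    (* For alpha = m the term of index 0 is an integral of order 1 with limit 0. The term of index i
       + 1 has order -i, so it is the i-th derivative, with the exponent n - (i + 1) - 1 = m - i - 1
       of an m-fold integration by parts. *)
    have sumS (c : nat -> R[i]) : \sum_(0 <= i < n) c i = c 0%N + \sum_(0 <= i < m) c i.+1.
      by rewrite nm big_nat_recl.
    have o0 : n%:R - 0%:R - alpha = 1 by rewrite aE nm -addn1 natrD; ring.
    have oS i : n%:R - i.+1%:R - alpha = - i%:R.
      by rewrite aE nm -[m.+1]addn1 -[i.+1]addn1 !natrD; ring.
    rewrite aE RLder_defined_nat in Dd; rewrite aE RLder_nat in Dc De.
    have R10 : ccvg 0^'+ (RLint w (n%:R - 0%:R - alpha) f) 0.
      by rewrite o0 /RLint ltr01; exact: RLint_pos1_0.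
    have [em cm H] := weighted_iter w_neq0 cw w0 Dd Dc De.
    split; [exact: wc0| |].
      case=> [|i] ilt; first exact: ccvg_cvg0 R10.
      by rewrite oS RLint_oppn; apply: cm; rewrite nm ltnS in ilt; exact: ltnW.
    have LD := Lu _ (em m (leqnn m)).
    apply: for_large_ReS (for_large_Re_and L0 (for_large_Re_and Lwf
      (for_large_Re_and LD H))) => s [s0 [[W1 E1] [[W2 E2] E3]]].
    rewrite {1 2}aE RLder_nat; split; [exact: W1|exact: W2|].
    rewrite E2 E3 E1 {1}aE cpow_nat ?neq0//; congr (_ - _ * _).
    have T0 : s ^+ (n - 0 - 1) * lim0 (RLint w (n%:R - 0%:R - alpha) f) = 0.
      by rewrite (ccvg_lim0 R10) mulr0.
    rewrite [RHS]sumS [X in _ = X + _]T0 add0r.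
    by apply: eq_big_nat => i _; rewrite oS RLint_oppn nm subSS.
  have fo : frac_order alpha = n by exact: frac_orderE.
  have nanE : (RLder w alpha f) = iter n (wD w) (RLint_pos w (n%:R - alpha) f).
    by rewrite /RLder (negbTE aN) fo.
  rewrite /RLder_defined (negbTE aN) fo in Dd; rewrite nanE in Dc De.
  have na0 : 0 < complex.Re (n%:R - alpha) by rewrite !ReImE subr_gt0.
  (* For non-integer order the n derivatives act on the integral of order n - alpha of [f], whose
     transform is s^(alpha - n) times that of [f]; this turns s^n into s^alpha. *)
  have [em cm H] := weighted_iter w_neq0 cw w0 Dd Dc De.
  have oE i : (i < n)%N -> RLint w (n%:R - i%:R - alpha) f =
      iter i (wD w) (RLint_pos w (n%:R - alpha) f) by exact: RLint_fractional.
  split; [exact: wc0| |].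
    by move=> i ilt; rewrite (oE i ilt); exact: cm (ltnW ilt).
  have LD := Lu _ (em n (leqnn n)); have LI := Lu _ (em 0%N isT).
  have HI := RLint_pos_laplace w_neq0 na0 ef.
  apply: for_large_ReS (for_large_Re_and L0 (for_large_Re_and (for_large_Re_and Lwf LI)
    (for_large_Re_and (for_large_Re_and LD HI) H)))
    => s [s0 [[[W1 E1] [_ E4]] [[[W2 E2] [_ E5]] E3]]].
  rewrite nanE; split; [exact: W1|exact: W2|].
  rewrite E2 E3 E1 -[X in s ^+ n * X]E4 E5 mulrA.
  congr (_ * _ - _ * _).
    by rewrite -(cpow_nat _ (neq0 _ s0)) -cpowD; congr cpow; ring.
  by apply: eq_big_nat => i /andP[_ ilt]; rewrite (oE i ilt).
- move=> n n0 an; rewrite RLder_defined_nat RLder_nat => Dd Dc De.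
  have /andP[h1 h2] := an.
  (* In the Caputo derivative the outer operator is always a genuine integral, of order 1 when alpha
     is an integer, so no case split is made. Its factor s^(alpha - n) multiplies the whole formula
     for the n-th derivative, including each boundary term. *)
  have na0 : 0 < complex.Re (n%:R - alpha) by rewrite !ReImE subr_gt0.
  have [em cm H] := weighted_iter w_neq0 cw w0 Dd Dc De.
  split; [exact: wc0|by move=> i ilt; exact: cm (ltnW ilt)|].
  have HI := RLint_pos_laplace w_neq0 na0 (em n (leqnn n)).
  rewrite /Cder (frac_orderE n0 an) /RLint na0.
  apply: for_large_ReS (for_large_Re_and L0 (for_large_Re_and Lwf
    (for_large_Re_and HI H))) => s [s0 [[W1 E1] [[W2 E2] E3]]].
  split; [exact: W1|exact: W2|].
  rewrite E2 E3 E1 mulrBr mulrA; congr (_ * _ - _).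
    by rewrite -(cpow_nat _ (neq0 _ s0)) -cpowD; congr cpow; ring.
  rewrite mulrCA; congr (_ * _); rewrite mulr_sumr; apply: eq_big_nat => i /andP[_ ilt].
  have sn := neq0 _ s0.
  rewrite mulrA -(cpow_nat _ sn) -cpowD; congr (cpow _ _ * _).
  by rewrite -subnDA natrB ?addn1// -[i.+1]addn1 natrD; ring.
Qed.
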